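(* Let $\lambda$ be an inaccessible cardinal, let $\theta<\lambda$ be an uncountable regular cardinal such that $\mathrm{GH}(\theta,\lambda)=\lambda$, and let $\gamma=\lambda\times n^*+\beta^*<\lambda\times\omega$, where $n^*<\omega$ and $\beta^*<\lambda$. If $\langle S_i : i<\theta\rangle$ is a $\subseteq$-increasing sequence of subsets of $S^\lambda_{>\theta}=\{\alpha<\lambda : \mathrm{cf}(\alpha)>\theta\}$ such that $\mathrm{rk}_\lambda(S_i)<\gamma$ for each $i<\theta$, then $$\mathrm{rk}_\lambda\Big(\bigcup_{i<\theta}S_i\Big)<\lambda\times n^*+\mathrm{GH}(\theta,\beta^* )<\lambda\times(n^*+1).$$
   Context: ''Inaccessible'' means weakly inaccessible (uncountable regular limit cardinal). Sums and products of ordinals are ordinal arithmetic. Trace operator. For an ordinal $\lambda$ of uncountable cofinality and $S\subseteq\lambda$, $\mathrm{Tr}(S)=\{\alpha<\lambda : S\cap\alpha\text{ is stationary in }\alpha\}$ (only $\alpha$ of uncountable cofinality can belong to it). For $\alpha<\lambda$: $\mathrm{Tr}_0(S)=S$, $\mathrm{Tr}_{\alpha+1}(S)=\mathrm{Tr}(\mathrm{Tr}_\alpha(S))$, and $\mathrm{Tr}_\alpha(S)=\bigcap_{\beta<\alpha}\mathrm{Tr}_\beta(S)$ for $\alpha$ limit. If $\lambda$ is inaccessible, fix for every limit ordinal $\alpha$ with $\lambda\le\alpha<\lambda^+$ a club $e_\alpha\subseteq\alpha$, of order type $\lambda$ when $\mathrm{cf}(\alpha)=\lambda$ and of cardinality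 $<\lambda$ when $\mathrm{cf}(\alpha)<\lambda$, and extend the definition to $\lambda\le\alpha<\lambda^+$: $\mathrm{Tr}_{\alpha+1}(S)=\mathrm{Tr}(\mathrm{Tr}_\alpha(S))$; $\mathrm{Tr}_\alpha(S)=\bigcap_{\beta\in e_\alpha}\mathrm{Tr}_\beta(S)$ if $\alpha$ is limit with $\mathrm{cf}(\alpha)<\lambda$; and $\mathrm{Tr}_\alpha(S)$ is the diagonal intersection of $\langle \mathrm{Tr}_\beta(S):\beta\in e_\alpha\rangle$ (along the increasing enumeration of $e_\alpha$) if $\mathrm{cf}(\alpha)=\lambda$. Modulo the nonstationary ideal, these sets do not depend on the choice of the $e_\alpha$. Rank. For $S\subseteq\lambda$, $\mathrm{rk}_\lambda(S)$ is the least $\alpha<\lambda^+$ such that $\mathrm{Tr}_\alpha(S)$ is nonstationary in $\lambda$. Galvin–Hajnal rank. For an uncountable regular cardinal $\theta$ and a function $f$ from $\theta$ to the ordinals, $\|f\|=\sup\{\|g\|+1 : g<_{bd}f\}$, where $g<_{bd}f$ means that $\{i<\theta : g(i)\ge f(i)\}$ is bounded in $\theta$. For an ordinal $\delta$, $\mathrm{GH}(\theta,\delta)=\min\{\alpha : (\forall f\in{}^\theta\delta)(\|f\|<\alpha)\}$.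
   Formalization: The fixed clubs e_α (limit α with λ ≤ α < λ^+) are also required to contain 0; for arbitrary clubs the sets Tr_α(S) can depend on the choice modulo the nonstationary ideal, and the claimed bound can fail (consistently, for λ of large Mahlo order). *)

(* Defs.v *)
From HB Require Import structures.
From mathcomp Require Import all_boot all_order.
From mathcomp Require Import generic_quotient.
From mathcomp Require Import boolp classical_sets cardinality.

Set Implicit Arguments.
Unset Strict Implicit.
Unset Printing Implicit Defensive.

Import Order.TTheory.

Local Open Scope classical_set_scope.
Local Open Scope quotient_scope.
Local Open Scope order_scope.

(******************************************************************************)
(* The tree OTree f denotes the ordinal sup_a (f a + 1), and an ordinal is a  *)
(* class of trees denoting the same ordinal.  The type ord lives one universe *)
(* above the types that index trees: it plays the role of the proper class of *)
(* all ordinals, and sets of type set ord need not have an upper bound.       *)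
(******************************************************************************)

Inductive otree : Type := OTree (A : Type) (f : A -> otree).

Fixpoint otle (x y : otree) : Prop :=
  match x, y with
  | @OTree A f, @OTree B g => forall a : A, exists b : B, otle (f a) (g b)
  end.

Definition otlt (x y : otree) : Prop :=
  match y with @OTree B g => exists b : B, otle x (g b) end.

Lemma otle_refl x : otle x x.
Proof. by elim: x => A f IH /= a; exists a. Qed.

Lemma otle_trans x y z : otle x y -> otle y z -> otle x z.
Proof.
elim: x y z => A f IH [B g] [C h] /= xy yz a.
by have [b ab] := xy a; have [c bc] := yz b; exists c; apply: IH ab bc.
Qed.

Lemma otltW x y : otlt x y -> otle x y.
Proof.
elim: x y => A f IH [B g] /= [b xb] a; exists b; apply: IH.
by case: (g b) xb => C h /= /(_ a).
Qed.

Lemma otle_or_otlt x y : otle x y \/ otlt y x.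
Proof.
elim: x y => A f IH [B g].
have [|nxy] := pselect (otle (OTree f) (OTree g)); first by left.
right; move/existsNP : nxy => [a /forallNP na]; exists a.
have: forall b, otlt (g b) (f a) by move=> b; have [/na|] := IH a (g b).
by case: (f a) => C h.
Qed.

Lemma otle_total x y : otle x y \/ otle y x.
Proof. by have [|/otltW] := otle_or_otlt x y; [left|right]. Qed.

HB.instance Definition _ := gen_eqMixin otree.
HB.instance Definition _ := gen_choiceMixin otree.

Definition oteqv (x y : otree) : bool := `[< otle x y /\ otle y x >].

Lemma oteqv_equiv : equiv_class_of oteqv.
Proof.
split=> [x|x y|y x z]; first by apply/asboolP; split; exact: otle_refl.
  by apply/asboolP/asboolP => -[].
move=> /asboolP[xy yx] /asboolP[yz zy]; apply/asboolP.
by split; [exact: otle_trans yz | exact: otle_trans yx].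
Qed.

Canonical oteqv_equivRel := EquivRelPack oteqv_equiv.

Definition ord := {eq_quot oteqv}.
HB.instance Definition _ := Choice.on ord.
HB.instance Definition _ := EqQuotient.on ord.

Definition ordle (a b : ord) : bool := `[< otle (repr a) (repr b) >].

Fact ordle_refl : reflexive ordle.
Proof. by move=> a; apply/asboolP; exact: otle_refl. Qed.

Fact ordle_anti : antisymmetric ordle.
Proof.
move=> a b /andP[/asboolP ab /asboolP ba].
by rewrite -[a]reprK -[b]reprK; apply/eqmodP/asboolP.
Qed.

Fact ordle_trans : transitive ordle.
Proof.
move=> b a c /asboolP ab /asboolP bc.
by apply/asboolP; exact: otle_trans bc.
Qed.

Fact ordle_total : total ordle.
Proof.
move=> a b; apply/orP.
by have [|] := otle_total (repr a) (repr b) => /asboolP; [left|right].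
Qed.

Fact ord_display : Order.disp_t. Proof. exact: Order.Disp tt tt. Qed.

HB.instance Definition _ :=
  Order.Le_isPOrder.Build ord_display ord ordle_refl ordle_anti ordle_trans.
HB.instance Definition _ :=
  Order.POrder_isTotal.Build ord_display ord ordle_total.

Lemma ord_lt_wf : well_founded (fun a b : ord => a < b).
Proof.
suff H (t : otree) (a : ord) : otle (repr a) t -> Acc (fun a b : ord => a < b) a.
  by move=> a; apply: (H (repr a)); exact: otle_refl.
elim: t a => A f IH a at_; constructor => b; rewrite ltNge => /negP ba.
have [/asboolP//|] := otle_or_otlt (repr a) (repr b).
case: (repr a) at_ => B g gf [c bc].
by have [i ci] := gf c; apply: (IH i); exact: otle_trans ci.
Qed.

Definition ozero : ord := \pi_ord (OTree (fun v : void => match v with end)).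
Definition osucc (a : ord) : ord := \pi_ord (OTree (fun _ : unit => repr a)).
Definition onat (n : nat) : ord := iter n osucc ozero.
Definition oomega : ord := \pi_ord (OTree (fun n : nat => repr (onat n))).

(* a + b is the least ordinal above all d < a and all a + c with c < b.      *)
Fixpoint otadd (x y : otree) : otree :=
  match x, y with
  | @OTree A f, @OTree B g =>
      OTree (fun u : A + B =>
               match u with inl a => f a | inr b => otadd x (g b) end)
  end.

(* a * b is the least ordinal above all a * c + d with c < b and d < a.       *)
Fixpoint otmul (x y : otree) : otree :=
  match x, y with
  | @OTree A f, @OTree B g =>
      OTree (fun u : B * A => otadd (otmul x (g u.1)) (f u.2))
  end.

Definition oadd (a b : ord) : ord := \pi_ord (otadd (repr a) (repr b)).
Definition omul (a b : ord) : ord := \pi_ord (otmul (repr a) (repr b)).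

Declare Scope ord_scope.
Delimit Scope ord_scope with ord.
Notation "a + b" := (oadd a b) : ord_scope.
Notation "a * b" := (omul a b) : ord_scope.

(* Junk values: both are ozero on the empty set, and osup is ozero on a set   *)
(* without upper bound.                                                       *)
Definition osup (X : set ord) : ord := supremum ozero X.
Definition omin (X : set ord) : ord := infimum ozero X.

Definition below (a : ord) : set ord := [set x | x < a].

Definition olimit (a : ord) : Prop :=
  ozero < a /\ forall b, b < a -> osucc b < a.

Definition cof (a : ord) : ord :=
  omin [set m | exists h : ord -> ord,
          (forall x, x < m -> h x < a) /\
          (forall y, y < a -> exists x, x < m /\ y <= h x)].

Definition is_card (k : ord) : Prop :=
  forall a, a < k -> ~ (below k #<= below a)%card.

Definition card_succ (a : ord) : ord :=
  omin [set k | is_card k /\ a < k].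

(* Regular ordinals are cardinals, so is_card need not be repeated. *)
Definition uncountable_regular (k : ord) : Prop :=
  oomega < k /\ cof k = k.

Definition inaccessible (k : ord) : Prop :=
  uncountable_regular k /\ forall a, a < k -> card_succ a < k.

Definition unbounded (a : ord) (C : set ord) : Prop :=
  forall x, x < a -> exists y, [/\ C y, x < y & y < a].

Definition club (a : ord) (C : set ord) : Prop :=
  [/\ C `<=` below a, unbounded a C &
      forall d, d < a -> olimit d -> unbounded d C -> C d].

Definition stationary (a : ord) (S : set ord) : Prop :=
  oomega < cof a /\ forall C, club a C -> S `&` C !=set0.

Definition trace (lam : ord) (S : set ord) : set ord :=
  [set a | a < lam /\ stationary a (S `&` below a)].

(* h restricted to m is the increasing enumeration of A; in particular the    *)
(* order type of A is m.                                                      *)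
Definition is_enum (m : ord) (A : set ord) (h : ord -> ord) : Prop :=
  (forall x y, x < y -> y < m -> h x < h y) /\ h @` below m = A.

Definition oenum (m : ord) (A : set ord) : ord -> ord :=
  xget (fun x : ord => x) (is_enum m A).

(* The clause ozero \in e a makes tr_iter lam e a S a subset of S (up to a    *)
(* bounded set) at limit stages a >= lam, as it is at limit stages a < lam.   *)
(* Without it the sets tr_iter lam e a S do depend on e modulo the            *)
(* nonstationary ideal: a ladder of lam + omega consisting of the lam + n     *)
(* with n > 0 need not give the same set as one which also contains lam.      *)
Definition club_system (lam : ord) (e : ord -> set ord) : Prop :=
  forall a, olimit a -> lam <= a -> a < card_succ lam ->
    [/\ club a (e a),
        e a ozero,
        cof a = lam -> exists h, is_enum lam (e a) h &
        cof a < lam -> ~ (below lam #<= e a)%card].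

(* T b _ stands for Tr_b(S), b < a.                                           *)
Definition tr_step (lam : ord) (e : ord -> set ord) (S : set ord) (a : ord)
    (T : forall b, b < a -> set ord) : set ord :=
  [set x | x < lam /\
    [\/ a = ozero /\ S x,
        exists b (ba : b < a), a = osucc b /\ trace lam (T b ba) x,
        [/\ olimit a, a < lam & forall b (ba : b < a), T b ba x] |
        [/\ olimit a, lam <= a &
          if cof a < lam then forall b (ba : b < a), e a b -> T b ba x
          else forall xi (ba : oenum lam (e a) xi < a), xi < x -> T _ ba x]]].

Definition tr_iter (lam : ord) (e : ord -> set ord) (a : ord) (S : set ord) :
    set ord :=
  Fix ord_lt_wf (fun=> set ord) (tr_step lam e S) a.

Lemma tr_iterE lam e a S :
  tr_iter lam e a S = tr_step lam e S (fun b (_ : b < a) => tr_iter lam e b S).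
Proof.
rewrite /tr_iter Fix_eq// => {}a f g fg.
by suff -> : f = g by []; apply: functional_extensionality_dep => b;
  apply: funext => ba; exact: fg.
Qed.

(* The value is card_succ lam when no a < card_succ lam is as required. *)
Definition rk (lam : ord) (e : ord -> set ord) (S : set ord) : ord :=
  omin ([set a | a < card_succ lam /\ ~ stationary lam (tr_iter lam e a S)]
        `|` [set card_succ lam]).

Definition cof_gt (lam theta : ord) : set ord :=
  [set a | a < lam /\ theta < cof a].

(* Functions on theta are functions ord -> ord of which only the values below *)
(* theta matter.                                                              *)
Definition lt_bd (theta : ord) (g f : ord -> ord) : Prop :=
  exists b, b < theta /\ forall i, i < theta -> f i <= g i -> i < b.

Definition GHnorm_step (theta : ord) (f : ord -> ord)
    (N : forall g, lt_bd theta g f -> ord) : ord :=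
  osup [set a | exists g (gf : lt_bd theta g f), a = osucc (N g gf)].

(* lt_bd theta is well-founded when theta is regular and uncountable;         *)
(* otherwise the norm is ozero outside its well-founded part.                 *)
Definition GHnorm (theta : ord) (f : ord -> ord) : ord :=
  match pselect (Acc (lt_bd theta) f) with
  | left acc => Fix_F (fun=> ord) (@GHnorm_step theta) acc
  | right _ => ozero
  end.

Lemma GHnormE theta f : Acc (lt_bd theta) f ->
  GHnorm theta f =
    osup [set a | exists2 g, lt_bd theta g f & a = osucc (GHnorm theta g)].
Proof.
have H g (p : Acc (lt_bd theta) g) :
    GHnorm theta g = Fix_F (fun=> ord) (@GHnorm_step theta) p.
  by rewrite /GHnorm; case: pselect => // q; rewrite (Prop_irrelevance q p).
case=> accf; rewrite (H _ (Acc_intro f accf)) /= /GHnorm_step; congr osup.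
apply/seteqP; split=> a /=.
  by move=> [g [gf ->]]; exists g; rewrite ?(H _ (accf g gf)).
by move=> [g gf ->]; exists g, gf; rewrite (H _ (accf g gf)).
Qed.

Definition GH (theta delta : ord) : ord :=
  omin [set a | forall f : ord -> ord,
          (forall i, i < theta -> f i < delta) -> GHnorm theta f < a].

(* Main.v *)
Require Import Defs.
From mathcomp Require Import all_boot all_order.
From mathcomp Require Import generic_quotient.
From mathcomp Require Import boolp classical_sets cardinality.

Set Implicit Arguments.
Unset Strict Implicit.
Unset Printing Implicit Defensive.

Import Order.TTheory.

Local Open Scope classical_set_scope.
Local Open Scope quotient_scope.
Local Open Scope order_scope.

(******************************************************************************)
(* Let U be the union of the S_i.  For x <= lam with cf(x) > theta, write     *)
(* F(i) for the least b such that Tr_b(S_i) is nonstationary in x.  If        *)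
(* Tr_a(U) is stationary in x, then a < ||F||: for a = d + m with d zero or   *)
(* limit, going down m + 1 times inside a club of x that avoids all           *)
(* Tr_F(i)(S_i) one reaches a point z of Tr_d(U) whose own function G         *)
(* satisfies G(i) + m + 1 <= F(i) for all large i, while d <= ||G|| by        *)
(* induction.  For x = lam this is the case n = 0 of the theorem.             *)
(*                                                                            *)
(* Put D(S) = {x : x in Tr_b(S) for all b < x}.  Modulo the nonstationary     *)
(* ideal, Tr_(lam * k + b)(S) is Tr_b(D^k(S)) for b < lam.  Moreover D^n(U)   *)
(* is almost contained in the union of the D^n(S_i): at a point x closed      *)
(* under b |-> GH(theta, b), ranks of x with respect to the S_i which are     *)
(* all below x are bounded below x as cf(x) > theta, and then the rank of x   *)
(* with respect to U is below x as well.  So the case n = 0, applied to the   *)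
(* D^n(S_i), gives the general one.                                           *)
(******************************************************************************)

(** * Ordinals *)

(** The argument sketched above rests on [stationary_lt_GHnorm], fed by [trace_descent]: if
    Tr_F(i)(S_i) is nonstationary for all large i, then every a < lam for which Tr_a of the union is
    stationary lies below ||F||. The descent intersects theta many clubs at each point it visits,
    which is possible since those points have cofinality above theta ([stationary_cof_gt]). The
    equation GH(theta, lam) = lam keeps the norms involved below lam.

    Levels past lam are reduced to levels below lam by [canonicalP], which uses the normality of the
    club filter ([subNS_diag]), and [iter_dtr_bigcup] moves the union through the iterates of D,
    here [dtr]. These are assembled in [rk_bigcup_lt] for beta > 0. If beta = 0, then n = m + 1, and
    theta many ranks below lam * m + lam lie below a single lam * m + y with y < lam, so that the
    positive case applies. *)

Lemma ord_ind (P : ord -> Prop) :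
  (forall a, (forall b, b < a -> P b) -> P a) -> forall a, P a.
Proof. by move=> H a; elim: (ord_lt_wf a) => b _ /H. Qed.

Lemma ord_least (X : set ord) : X !=set0 ->
  exists a, X a /\ forall b, X b -> a <= b.
Proof.
move=> [a]; elim/ord_ind: a => a IH Xa.
have [[b [ba Xb]]|nb] := pselect (exists b, b < a /\ X b); first exact: IH ba Xb.
by exists a; split=> // b Xb; rewrite leNgt; apply/negP => ba; apply: nb; exists b.
Qed.

Lemma omin_least (X : set ord) : X !=set0 ->
  X (omin X) /\ forall b, X b -> omin X <= b.
Proof.
move=> X0; have [a [Xa lea]] := ord_least X0.
have infa : infimums X a by split=> [b /lea//|b /(_ a Xa)].
rewrite /omin /infimum ifF; last by apply/negbTE/set0P.
by rewrite (xget_unique _ infa) // => b Xb; exact: is_subset1_infimums Xb infa.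
Qed.

Lemma omin_in (X : set ord) a : X a -> X (omin X).
Proof. by move=> Xa; have [] := omin_least (ex_intro _ a Xa). Qed.

Lemma omin_le (X : set ord) a : X a -> omin X <= a.
Proof. by move=> Xa; have [_] := omin_least (ex_intro _ a Xa); exact. Qed.

Lemma omin0 : omin set0 = ozero.
Proof. by rewrite /omin /infimum ifT. Qed.

(** The disjunct [osup X = ozero] covers the empty [X], where [supremum] takes its default value. *)
Lemma osup_least (X : set ord) (u : ord) : (forall a, X a -> a <= u) ->
  (forall a, X a -> a <= osup X) /\
  (forall v, (forall a, X a -> a <= v) -> osup X <= v \/ osup X = ozero).
Proof.
move=> Xu; have [s [us les]] := @ord_least (ubound X) (ex_intro _ u Xu).
rewrite /osup /supremum; case: ifPn => [/eqP ->|_].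
  by split=> // v _; right.
have sups : supremums X s by split.
rewrite (xget_unique _ sups); last by move=> b Xb; exact: is_subset1_supremums Xb sups.
by split=> // v Xv; left; exact: les.
Qed.

Lemma pi_le t u : (\pi_ord t <= \pi_ord u) = `[< otle t u >].
Proof.
have E v : oteqv (repr (\pi_ord v)) v by apply/eqmodP; rewrite reprK.
have /asboolP[t1 t2] := E t; have /asboolP[u1 u2] := E u.
rewrite /Order.le /= /ordle; apply/asboolP/asboolP => tu.
  by apply: otle_trans u1; apply: otle_trans tu.
by apply: otle_trans u2; apply: otle_trans tu.
Qed.

Lemma ord_pi (a : ord) : exists t, a = \pi_ord t.
Proof. by exists (repr a); rewrite reprK. Qed.

(** [OTree f] is the least ordinal above all its branches; strict inequalities below successors,
    omega and sums are read off from this. *)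
Lemma lt_pi (a : ord) A (f : A -> otree) :
  a < \pi_ord (OTree f) <-> exists i, a <= \pi_ord (f i).
Proof.
have [t ->] := ord_pi a; rewrite ltNge pi_le; split.
  move=> /asboolPn; have [//|[i ti] _] := otle_or_otlt (OTree f) t.
  by exists i; rewrite pi_le; apply/asboolP.
move=> [i]; rewrite pi_le => /asboolP ti; apply/asboolPn => ft.
have {ft} : otlt t t.
  by case: t ti ft => B g ti /= /(_ i) [b fb]; exists b; exact: otle_trans ti fb.
elim: t {f i A ti} => B g IH [b gb]; apply: (IH b).
by move: gb; case E: (g b) => [C h] /= /(_ b); rewrite E.
Qed.

Lemma lt_osucc (a b : ord) : (a < osucc b) = (a <= b).
Proof.
apply/idP/idP => [/lt_pi[[]]|ab]; first by rewrite reprK.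
by apply/lt_pi; exists tt; rewrite reprK.
Qed.

Lemma ozero_le (a : ord) : ozero <= a.
Proof. by rewrite leNgt; apply/negP; move=> /lt_pi[[]]. Qed.

Lemma osucc_gt (a : ord) : a < osucc a.
Proof. by rewrite lt_osucc. Qed.

Lemma osucc_le (a b : ord) : (osucc a <= b) = (a < b).
Proof. by rewrite leNgt lt_osucc -ltNge. Qed.

Lemma osucc_lt2 (a b : ord) : (osucc a < osucc b) = (a < b).
Proof. by rewrite lt_osucc osucc_le. Qed.

Lemma osucc_le2 (a b : ord) : (osucc a <= osucc b) = (a <= b).
Proof. by rewrite osucc_le lt_osucc. Qed.

Lemma osucc_inj : injective osucc.
Proof. by move=> a b ab; apply/eqP; rewrite eq_le -(osucc_le2 a) -(osucc_le2 b) ab lexx. Qed.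

Lemma ozero_lt_osucc (a : ord) : ozero < osucc a.
Proof. by rewrite lt_osucc ozero_le. Qed.

Lemma not_olimit_osucc (a : ord) : ~ olimit (osucc a).
Proof. by move=> [_ /(_ a (osucc_gt a))]; rewrite ltxx. Qed.

Variant ord_kind (a : ord) : Prop :=
  | KindZero of a = ozero
  | KindSucc b of a = osucc b
  | KindLimit of olimit a.

Lemma ord_kindP (a : ord) : ord_kind a.
Proof.
have [->|a0] := eqVneq a ozero; first exact: KindZero.
have [[b ->]|na] := pselect (exists b, a = osucc b); first exact: KindSucc.
apply: KindLimit; split; first by rewrite lt_neqAle eq_sym a0 ozero_le.
move=> b ba; rewrite lt_neqAle osucc_le ba andbT.
by apply/eqP => ab; apply: na; exists b.
Qed.

Lemma ord_decomp (a : ord) :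
  exists m d, a = iter m osucc d /\ (d = ozero \/ olimit d).
Proof.
elim/ord_ind: a => a IH; case: (ord_kindP a) => [->|b ab|la].
- by exists 0%N, ozero; split; [|left].
- have [m [d [bE dl]]] := IH b ltac:(by rewrite ab osucc_gt).
  by exists m.+1, d; split; rewrite // ab bE.
- by exists 0%N, a; split; [|right].
Qed.

Lemma iter_osucc_ge (m : nat) (a : ord) : a <= iter m osucc a.
Proof. by elim: m => //= m IH; apply: le_trans IH _; rewrite ltW ?osucc_gt. Qed.

Lemma iter_osucc_le (m : nat) (a b : ord) :
  a <= b -> iter m osucc a <= iter m osucc b.
Proof. by elim: m => //= m IH /IH; rewrite osucc_le2. Qed.

Lemma olimit_iter (m : nat) (a b : ord) :
  olimit b -> a < b -> iter m osucc a < b.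
Proof. by move=> lb ab; elim: m => //= m; exact: lb.2. Qed.

Lemma onat_lt (m n : nat) : (onat m < onat n) = (m < n)%N.
Proof.
elim: m n => [|m IH] [|n] /=; rewrite ?ltxx ?ozero_lt_osucc ?osucc_lt2 ?IH //.
by apply/negbTE; rewrite -leNgt ozero_le.
Qed.

Lemma lt_oomega (a : ord) : a < oomega <-> exists n, a = onat n.
Proof.
split=> [/lt_pi[n]|[n ->]]; last by apply/lt_pi; exists n; rewrite reprK.
rewrite reprK; elim: n a => [|n IH] a.
  by move=> a0; exists 0%N; apply/eqP; rewrite eq_le a0 ozero_le.
rewrite le_eqVlt => /predU1P[->|]; first by exists n.+1.
by rewrite lt_osucc => /IH.
Qed.

(** * Ordinal addition and multiplication *)

Lemma otadd_le x x' y y' :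
  otle x x' -> otle y y' -> otle (otadd x y) (otadd x' y').
Proof.
elim: y y' => B g IH [B' g'] xx' yy'.
case: x x' xx' IH => A f [A' f'] xx' IH [a|b] /=.
  by have [a' aa'] := xx' a; exists (inl a').
by have [b' bb'] := yy' b; exists (inr b'); exact: IH.
Qed.

Lemma oadd_pi x y : oadd (\pi_ord x) (\pi_ord y) = \pi_ord (otadd x y).
Proof.
have E v : otle (repr (\pi_ord v)) v /\ otle v (repr (\pi_ord v)).
  by have /eqmodP/asboolP := reprK (\pi_ord v).
have [x1 x2] := E x; have [y1 y2] := E y.
by apply/eqmodP/asboolP; split; exact: otadd_le.
Qed.

Lemma lt_oadd (c a b : ord) :
  c < oadd a b <-> c < a \/ exists d, d < b /\ c <= oadd a d.
Proof.
have [[A f] aE] := ord_pi a; have [[B g] bE] := ord_pi b.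
rewrite aE bE oadd_pi -!aE; split.
  move=> /lt_pi[[i|j] /= cu]; [left|right].
    by rewrite aE; apply/lt_pi; exists i.
  exists (\pi_ord (g j)); split; first by apply/lt_pi; exists j.
  by rewrite aE oadd_pi.
move=> [|[d []]]; first by rewrite aE => /lt_pi[i ci]; apply/lt_pi; exists (inl i).
have [t ->] := ord_pi d; move=> /lt_pi[j]; rewrite pi_le => /asboolP tj cd.
apply/lt_pi; exists (inr j); apply: le_trans cd _.
rewrite aE oadd_pi pi_le; apply/asboolP/otadd_le => //; exact: otle_refl.
Qed.

Lemma oadd_lt2l (a b c : ord) : b < c -> oadd a b < oadd a c.
Proof. by move=> bc; apply/lt_oadd; right; exists b. Qed.

Lemma oadd_le2l (a b c : ord) : b <= c -> oadd a b <= oadd a c.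
Proof.
by rewrite le_eqVlt => /predU1P[->//|bc]; exact/ltW/oadd_lt2l.
Qed.

Lemma oadd_ge (a b : ord) : a <= oadd a b.
Proof.
rewrite leNgt; apply/negP => h.
by have := (lt_oadd (oadd a b) a b).2 (or_introl h); rewrite ltxx.
Qed.

Lemma oaddo0 (a : ord) : oadd a ozero = a.
Proof.
apply/eqP; rewrite eq_le oadd_ge andbT leNgt; apply/negP.
by move=> /lt_oadd[|[d []]]; rewrite ?ltxx // ltNge ozero_le.
Qed.

Lemma oadd_subl (c a b : ord) :
  a <= c -> c < oadd a b -> exists d, d < b /\ c = oadd a d.
Proof.
elim/ord_ind: b c => b IH c ac /lt_oadd[|[d [db]]]; first by rewrite ltNge ac.
rewrite le_eqVlt => /predU1P[->|cd]; first by exists d.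
by have [d' [d'd ->]] := IH d db c ac cd; exists d'; split=> //; exact: lt_trans db.
Qed.

Lemma oaddS (a b : ord) : oadd a (osucc b) = osucc (oadd a b).
Proof.
apply/eqP; rewrite eq_le; apply/andP; split; last first.
  by rewrite osucc_le oadd_lt2l ?osucc_gt.
rewrite leNgt; apply/negP => /lt_oadd[|[d []]].
  by rewrite ltNge ltW // lt_osucc oadd_ge.
by rewrite lt_osucc osucc_le => /(oadd_le2l a) /le_lt_trans h /h; rewrite ltxx.
Qed.

Lemma oadd_ger (a b : ord) : b <= oadd a b.
Proof.
elim/ord_ind: b => b IH; rewrite leNgt; apply/negP => h.
by have := IH _ h; rewrite leNgt oadd_lt2l.
Qed.

Lemma olimit_oadd (a b : ord) : olimit b -> olimit (oadd a b).
Proof.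
move=> lb; split; first by apply: lt_le_trans lb.1 (oadd_ger _ _).
move=> c; case: (ltP c a) => [ca _|ac /(oadd_subl ac)[d [db ->]]].
  apply: le_lt_trans (oadd_lt2l a lb.1); rewrite oaddo0 osucc_le //.
by rewrite -oaddS oadd_lt2l // lb.2.
Qed.

Lemma olimit_oadd_lt (a b c : ord) :
  olimit b -> c < oadd a b -> exists d, d < b /\ c < oadd a d.
Proof.
move=> lb /lt_oadd[ca|[d [db cd]]].
  by exists ozero; rewrite oaddo0 lb.1.
by exists (osucc d); rewrite lb.2 // oaddS lt_osucc.
Qed.

Lemma otmul_ler x y y' : otle y y' -> otle (otmul x y) (otmul x y').
Proof.
elim: y y' => B g IH [B' g'] yy'; case: x IH => A f IH [b a] /=.
by have [b' bb'] := yy' b; exists (b', a); apply: otadd_le (IH _ _ bb') (otle_refl _).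
Qed.

Lemma omul_pi (a : ord) y : omul a (\pi_ord y) = \pi_ord (otmul (repr a) y).
Proof.
have /eqmodP/asboolP[y1 y2] := reprK (\pi_ord y).
by apply/eqmodP/asboolP; split; exact: otmul_ler.
Qed.

Lemma omul_onat0 (a : ord) : omul a (onat 0) = ozero.
Proof.
apply/eqP; rewrite eq_le ozero_le andbT leNgt /= /ozero omul_pi.
by apply/negP; case: (repr a) => A f /lt_pi[[[]]].
Qed.

Lemma omul_onatS (a : ord) n :
  ozero < a -> omul a (onat n.+1) = oadd (omul a (onat n)) a.
Proof.
move=> a0; rewrite /= /osucc omul_pi /omul -{3}(reprK a) oadd_pi.
move: a0; rewrite -{1}(reprK a); move: (repr (onat n)).
case: (repr a) => A f s /lt_pi[i0 _]; set m := otmul (OTree f) s.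
have -> : otmul (OTree f) (OTree (fun _ : unit => s)) =
  OTree (fun u : unit * A => otadd m (f u.2)) by [].
apply/eqP; rewrite eq_le !pi_le; move: m => [C h].
apply/andP; split; apply/asboolP => /=.
  by move=> [[] i]; exists (inr i); exact: otle_refl.
move=> [c|i]; last by exists (tt, i); exact: otle_refl.
exists (tt, i0); apply: otltW => /=; case: (f i0) => B g.
by exists (inl c); exact: otle_refl.
Qed.

Lemma oadd0o (a : ord) : oadd ozero a = a.
Proof.
apply/eqP; rewrite eq_le oadd_ger andbT.
elim/ord_ind: a => a IH; rewrite leNgt; apply/negP => /lt_oadd[|[d [da ad]]].
  by rewrite ltNge ozero_le.
by have := IH d da; rewrite leNgt (lt_le_trans da).
Qed.

(** Division with remainder by lam. The value b = lam is allowed because the induction rewrites lam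
    * (n + 1) as lam * n + lam. *)
Lemma lt_omul_onatD (lam b c : ord) n : ozero < lam -> b <= lam ->
  c < oadd (omul lam (onat n)) b ->
  exists j d, [/\ d < lam, c = oadd (omul lam (onat j)) d &
                  (j < n)%N \/ j = n /\ d < b].
Proof.
move=> lam0; elim: n b c => [|n IH] b c b_lam.
  rewrite omul_onat0 => /(oadd_subl (ozero_le c))[d [db ->]].
  by exists 0%N, d; rewrite omul_onat0; split; [exact: lt_le_trans b_lam| |right].
case: (ltP c (omul lam (onat n.+1))) => [+ _|ac /(oadd_subl ac)[d [db ->]]].
  rewrite omul_onatS // => /(IH _ _ (lexx _))[j [d [dl cE jn]]].
  by exists j, d; split=> //; left; case: jn => [/ltnW//|[-> _]].
by exists n.+1, d; split=> //; [exact: lt_le_trans b_lam|right].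
Qed.

Lemma omul_onat_ge (a : ord) n : ozero < a -> a <= omul a (onat n.+1).
Proof. by move=> a0; rewrite omul_onatS // oadd_ger. Qed.

(** * Cofinality and closed unbounded sets *)

(** Plays the role of |P| < cf(a), in the form in which it is used: P-indexed families below a are
    bounded below a. Any type can serve as index, and no cardinal arithmetic is involved. *)
Definition small (I : Type) (a : ord) (P : set I) : Prop :=
  forall h : I -> ord, (forall i, P i -> h i < a) ->
    exists y, y < a /\ forall i, P i -> h i < y.

Lemma cof_cofinal (a : ord) : exists h : ord -> ord,
  (forall x, x < cof a -> h x < a) /\
  (forall y, y < a -> exists x, x < cof a /\ y <= h x).
Proof.
rewrite /cof; set X := [set m | _].
suff Xa : X a by exact: (omin_in Xa).
by exists id; split=> // y ya; exists y.
Qed.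

Lemma cof_le (a m : ord) (h : ord -> ord) : (forall x, x < m -> h x < a) ->
  (forall y, y < a -> exists x, x < m /\ y <= h x) -> cof a <= m.
Proof. by move=> h1 h2; apply: omin_le; exists h. Qed.

Lemma cof_le_self (a : ord) : cof a <= a.
Proof. by apply: (@cof_le _ _ id) => // y ya; exists y. Qed.

Lemma small_below (a m : ord) : m < cof a -> small a (below m).
Proof.
move=> ma h ha; apply: contrapT => nb.
have : cof a <= m; last by rewrite leNgt ma.
apply: (@cof_le _ _ h) => // y ya; apply: contrapT => ny.
apply: nb; exists y; split=> // i im; rewrite ltNge; apply/negP => yh.
by apply: ny; exists i.
Qed.

Lemma small_image (I J : Type) (a : ord) (P : set I) (Q : set J) (k : I -> J) :
  (exists y, y < a) -> (forall j, Q j -> exists i, P i /\ k i = j) ->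
  small a P -> small a Q.
Proof.
move=> [y0 y0a] PQ sP h ha.
have [|y [ya hy]] := sP (fun i => if pselect (Q (k i)) then h (k i) else y0).
  by move=> i _; case: pselect => // Pi; exact: ha.
exists y; split=> // j Qj; have [i [Pi ij]] := PQ j Qj.
by have := hy i Pi; rewrite ij; case: pselect.
Qed.

Section Clubs.
Variables (a : ord).
Hypothesis cofa : oomega < cof a.

Lemma oomega_lt : oomega < a.
Proof. exact: lt_le_trans cofa (cof_le_self a). Qed.

Lemma ozero_lt_cof : ozero < a.
Proof. by apply: lt_trans oomega_lt; apply/lt_oomega; exists 0%N. Qed.

Lemma small_nat : small a [set: nat].
Proof.
apply: (@small_image _ _ a (below oomega) _ (fun x => xget 0%N [set n | x = onat n])).
- by exists ozero; exact: ozero_lt_cof.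
- move=> n _; exists (onat n); split; first by apply/lt_oomega; exists n.
  case: xgetP => [m _ /= /eqP|/(_ n)/(_ erefl)//].
  by rewrite eq_le !leNgt !onat_lt -!leqNgt -eqn_leq => /eqP.
- exact: (small_below cofa).
Qed.

Lemma olimit_cof : olimit a.
Proof.
split=> [|b ba]; first exact: ozero_lt_cof.
have [|y [ya by_]] := small_nat (h := fun=> b); first by [].
by apply: le_lt_trans ya; rewrite osucc_le (by_ 0%N).
Qed.

(* Intersections, diagonal intersections and limit points of clubs are all     *)
(* obtained as closure points of a relation R.                                 *)
Lemma club_closing (R : ord -> ord -> Prop) :
  (forall x x' y, x' <= x -> R x y -> R x' y) ->
  (forall x, x < a -> exists y, y < a /\ R x y) ->
  club a [set d | [/\ d < a, olimit d & forall x, x < d -> exists y, y < d /\ R x y]].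
Proof.
move=> Rmono Rex; split=> [d [] //|x xa|d da ld ud]; last first.
  split=> // x /ud[c [[ca lc hc] xc cd]].
  by have [y [yc Rxy]] := hc x xc; exists y; split=> //; exact: lt_trans cd.
have step x0 : exists y, x0 < a -> [/\ x0 < y, y < a & exists z, z <= y /\ R x0 z].
  have [x0a|] := pselect (x0 < a); last by exists x0.
  have [z [za Rz]] := Rex x0 x0a.
  exists (Order.max z (osucc x0)) => _; split.
  - by rewrite lt_max osucc_gt orbT.
  - by rewrite gt_max za olimit_cof.2.
  - by exists z; rewrite le_max lexx.
have [f fP] := choice step; pose u n := iter n f x.
have ua n : u n < a by elim: n => //= n /fP[].
have uS n : u n < u n.+1 by have [] := fP _ (ua n).
have umono m n : (m <= n)%N -> u m <= u n.
  elim: n => [|n IH]; first by rewrite leqn0 => /eqP->.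
  by rewrite leq_eqVlt => /predU1P[->//|/IH h]; exact: le_trans h (ltW (uS n)).
(* Uncountable cofinality bounds the sequence below a; its supremum d is then a limit closed under
   R. *)
have [b [ba ub]] : exists b, b < a /\ forall n, [set: nat] n -> u n < b.
  by apply: small_nat.
have [d [ud dmin]] := @ord_least [set d | forall n, u n < d] (ex_intro _ b (fun n => ub n I)).
have udP y : y < d -> exists n, y < u n.
  move=> yd; apply: contrapT => /forallNP ny.
  have : d <= y; last by rewrite leNgt yd.
  apply: dmin => n; apply: lt_le_trans (uS n) _.
  by rewrite leNgt; apply/negP; exact: ny.
exists d; split; [split|exact: (ud 0%N)|].
- by apply: le_lt_trans ba; apply: dmin => n; exact: ub.
- split=> [|y /udP[n yn]]; first by apply: le_lt_trans (ud 0%N); exact: ozero_le.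
  by apply: le_lt_trans (ud n); rewrite osucc_le.
- move=> y /udP[n yn]; have [_ _ [z [zu Rz]]] := fP _ (ua n).
  exists z; split; first exact: le_lt_trans (ud n.+1).
  exact: Rmono (ltW yn) Rz.
- by apply: le_lt_trans ba; apply: dmin => n; exact: ub.
Qed.

Lemma club_limits (A : set ord) : unbounded a A ->
  club a [set d | [/\ d < a, olimit d & unbounded d A]].
Proof.
move=> uA; have [|x xa|C1 C2 C3] := @club_closing (fun x y => exists c, [/\ A c, x < c & c <= y]).
- by move=> x x' y x'x [c [Ac xc cy]]; exists c; split=> //; exact: le_lt_trans xc.
- by have [c [Ac xc ca]] := uA x xa; exists c; split=> //; exists c.
have E : [set d | [/\ d < a, olimit d & unbounded d A]] =
  [set d | [/\ d < a, olimit d & forall x, x < d ->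
     exists y, y < d /\ exists c, [/\ A c, x < c & c <= y]]].
  apply/seteqP; split=> d [da ld ud]; split=> // x /ud.
    by move=> [c [Ac xc cd]]; exists c; split=> //; exists c.
  by move=> [y [yd [c [Ac xc cy]]]]; exists c; split=> //; exact: le_lt_trans yd.
by rewrite E; split.
Qed.

Lemma club_bigcap (I : Type) (P : set I) (C : I -> set ord) : small a P ->
  (forall i, P i -> club a (C i)) ->
  exists E, club a E /\ forall x i, E x -> P i -> C i x.
Proof.
move=> sP CP; pose R x y := forall i, P i -> exists c, [/\ C i c, x < c & c <= y].
exists [set d | [/\ d < a, olimit d & forall x, x < d -> exists y, y < d /\ R x y]].
split; last first.
  move=> d i [da ld hd] Pi; have [_ _ clC] := CP i Pi; apply: clC => // x /hd[y [yd Rxy]].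
  by have [c [Cc xc cy]] := Rxy i Pi; exists c; split=> //; exact: le_lt_trans yd.
apply: club_closing => [x x' y x'x Rxy i Pi|x xa].
  by have [c [Cc xc cy]] := Rxy i Pi; exists c; split=> //; exact: le_lt_trans xc.
have h1 i : exists c, P i -> [/\ C i c, x < c & c < a].
  have [Pi|] := pselect (P i); last by exists x.
  by have [_ uC _] := CP i Pi; have [c] := uC x xa; exists c.
have [h hP] := choice h1.
have [|y [ya hy]] := sP h; first by move=> i /hP[].
by exists y; split=> // i Pi; exists (h i); have [? ? ?] := hP i Pi; split=> //; exact/ltW/hy.
Qed.

Lemma club_setI (C D : set ord) : club a C -> club a D -> club a (C `&` D).
Proof.
move=> cC cD; have [E [cE ED]] : exists E, club a E /\ forall x (b : bool), E x -> setT b ->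
    (if b then C else D) x.
  apply: club_bigcap; last by case.
  apply: (small_image (k := fun n => n == 0%N)) small_nat.
    by exists ozero; exact: ozero_lt_cof.
  by case=> _; [exists 0%N|exists 1%N].
have [E1 E2 E3] := cE; have [C1 C2 C3] := cC; have [D1 D2 D3] := cD.
split=> [x [/C1]//|x /E2[y [Ey xy ya]]|d da ld ud].
  by exists y; split=> //; split; [exact: (ED y true)|exact: (ED y false)].
by split; [apply: C3|apply: D3] => // x /ud[y [[]]]; exists y.
Qed.

Lemma club_below : club a (below a).
Proof.
split=> // x xa; exists (osucc x); split; [|exact: osucc_gt|]; exact: olimit_cof.2.
Qed.

Lemma club_above b : b < a -> club a [set x | b < x /\ x < a].
Proof.
move=> ba; split=> [x []//|x xa|d da ld ud].
  exists (osucc (Order.max b x)); split; rewrite /= ?lt_osucc ?le_max ?lexx ?orbT //.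
  - by split=> //; apply: olimit_cof.2; rewrite gt_max ba.
  - by apply: olimit_cof.2; rewrite gt_max ba.
split=> //; have [y [[by_ _] _ yd]] := ud _ ld.1; exact: lt_trans yd.
Qed.

End Clubs.

Lemma club_restrict (a x : ord) C : club a C -> x <= a -> unbounded x C ->
  club x (C `&` below x).
Proof.
move=> [C1 C2 C3] xa ux; split=> [y []//|y /ux[c [Cc yc cx]]|d dx ld ud].
  by exists c; split.
split=> //; apply: C3 => //; first exact: lt_le_trans xa.
by move=> y /ud[c [[Cc _] yc cd]]; exists c.
Qed.

(** * Stationary sets and traces *)

Lemma stationary_sub (x : ord) (A B : set ord) :
  (forall y, y < x -> A y -> B y) -> stationary x A -> stationary x B.
Proof.
move=> AB [cx sA]; split=> // C cC; have [y [Ay Cy]] := sA C cC.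
by exists y; split=> //; apply: AB => //; have [C1 _ _] := cC; exact: C1.
Qed.

Lemma stationaryI (x : ord) (A C : set ord) :
  stationary x A -> club x C -> stationary x (A `&` C).
Proof.
move=> [cx sA] cC; split=> // D cD.
by have [y [Ay [Cy Dy]]] := sA _ (club_setI cx cC cD); exists y.
Qed.

Lemma nonstationary_club (x : ord) (A : set ord) : oomega < cof x ->
  ~ stationary x A -> exists C, club x C /\ forall y, C y -> ~ A y.
Proof.
move=> cx nA; apply: contrapT => nC; apply: nA; split=> // C cC.
apply: contrapT => AC; apply: nC; exists C; split=> // y Cy Ay.
by apply: AC; exists y.
Qed.

Lemma traceP (lam : ord) (A : set ord) x :
  trace lam A x <-> x < lam /\ stationary x A.
Proof.
by split=> -[xl sA]; split=> //; apply: stationary_sub sA => y // yx [].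
Qed.

Lemma trace_sub (lam : ord) (A B : set ord) :
  A `<=` B -> trace lam A `<=` trace lam B.
Proof.
move=> AB x /traceP[xl sA]; apply/traceP; split=> //.
by apply: stationary_sub sA => y _ /AB.
Qed.

(** A club C of x has a limit point y in Tr(A); there C is a club of y, so it meets A. *)
Lemma trace_idem (lam : ord) (A : set ord) :
  trace lam (trace lam A) `<=` trace lam A.
Proof.
move=> x /traceP[xl [cx sA]]; apply/traceP; split=> //; split=> // C cC.
have [_ uC _] := cC.
have [y [/traceP[yl [cy sy]] [yx ly uy]]] := sA _ (club_limits cx uC).
have [z [Az [Cz _]]] := sy _ (club_restrict cC (ltW yx) uy).
by exists z.
Qed.

(* The limit points of a cofinal map from cof x to x form a club of points of *)
(* cofinality at most cof x, which misses A when cof x <= theta.              *)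
Lemma stationary_cof_gt (lam theta x : ord) (A : set ord) :
  A `<=` cof_gt lam theta -> stationary x A -> theta < cof x.
Proof.
move=> Ath [cx sA]; rewrite ltNge; apply/negP => cth.
have [h [hx hcof]] := cof_cofinal x.
pose H := [set y | exists z, z < cof x /\ y = h z].
have uH : unbounded x H.
  move=> y yx; have [z [zc yz]] := hcof _ ((olimit_cof cx).2 y yx).
  exists (h z); split; [by exists z| |exact: hx].
  by apply: lt_le_trans yz; exact: osucc_gt.
have [y [/Ath[_ thy] [yx ly uy]]] := sA _ (club_limits cx uH).
have : cof y <= cof x; last by rewrite leNgt (le_lt_trans cth).
apply: (@cof_le _ _ (fun z => if h z < y then h z else ozero)) => [z _|z zy].
  by case: ifP => // _; exact: ly.1.
have [c [[w [wc ->]] zw wy]] := uy z zy.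
by exists w; rewrite wy; split=> //; exact: ltW.
Qed.

(** * Iterated traces below lam and the diagonal trace *)

Section Iterates.
Variables (lam : ord) (e : ord -> set ord).
Local Notation tr := (tr_iter lam e).

Lemma tr_zero S x : tr ozero S x <-> x < lam /\ S x.
Proof.
rewrite tr_iterE; split=> [[xl]|[xl Sx]]; last by split=> //; constructor 1.
case=> [[_ Sx]//|[b [b0 _]]|[l0 _ _]|[l0 _ _]].
- by move: b0; rewrite ltNge ozero_le.
- by have := l0.1; rewrite ltxx.
- by have := l0.1; rewrite ltxx.
Qed.

Lemma tr_succ S b : tr (osucc b) S = trace lam (tr b S).
Proof.
apply/seteqP; split=> x; rewrite (tr_iterE _ _ (osucc b)).
  move=> [xl [[b0 _]|[c [cb [/osucc_inj -> //]]]|[/not_olimit_osucc //]|[/not_olimit_osucc //]]].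
  by have := ozero_lt_osucc b; rewrite b0 ltxx.
move=> trx; split; first by have [] := (traceP _ _ _).1 trx.
by constructor 2; exists b, (osucc_gt b).
Qed.

Lemma tr_limit_lt S a x : olimit a -> a < lam ->
  tr a S x <-> x < lam /\ forall b, b < a -> tr b S x.
Proof.
move=> la al; rewrite tr_iterE; split=> [[xl]|[xl ax]]; last by split=> //; constructor 3.
case=> [[a0]|[b [_ [ab]]]|[_ _ H]|[_]]; first by move: la.1; rewrite a0 ltxx.
- by move: la; rewrite ab => /not_olimit_osucc.
- by split.
- by rewrite leNgt al.
Qed.

Lemma tr_lt_lam S a x : tr a S x -> x < lam.
Proof. by rewrite tr_iterE => -[]. Qed.

Lemma tr_succP S b x : tr (osucc b) S x <-> x < lam /\ stationary x (tr b S).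
Proof. by rewrite tr_succ; exact: traceP. Qed.

(** Only successor stages are compared: Tr(S) need not be included in S, and likewise Tr_(a+1) need
    not be included in Tr_a for a limit. Between successors, [trace_idem] gives the inclusion. *)
Lemma tr_succ_le S b a : b <= a -> a < lam ->
  tr (osucc a) S `<=` tr (osucc b) S.
Proof.
elim/ord_ind: a => a IH; rewrite le_eqVlt => /predU1P[->|ba] al; first exact: subset_refl.
rewrite tr_succ; case: (ord_kindP a) => [a0|c ac|la].
- by move: ba; rewrite a0 ltNge ozero_le.
- move: IH ba al; rewrite {}ac => IH ba al.
  rewrite tr_succ; apply: subset_trans (@trace_idem _ _) _; rewrite -tr_succ.
  apply: IH; [exact: osucc_gt|by rewrite -lt_osucc|exact: lt_trans (osucc_gt _) al].
- by rewrite tr_succ; apply: trace_sub => x /tr_limit_lt[]// _; apply.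
Qed.

Lemma tr_lt_succ S b a : b < a -> a < lam -> tr a S `<=` tr (osucc b) S.
Proof.
move=> ba al; case: (ord_kindP a) => [a0|c ac|la].
- by move: ba; rewrite a0 ltNge ozero_le.
- rewrite ac; apply: tr_succ_le; first by rewrite -lt_osucc -ac.
  by apply: lt_trans al; rewrite ac osucc_gt.
- by move=> x /tr_limit_lt[]// _; apply; exact: la.2.
Qed.

(** Successor stages say nothing about stage zero, which also enters every limit stage; the
    hypothesis S x supplies it. *)
Lemma tr_of_succ (S : set ord) a x : S x -> x < lam -> a < lam ->
  (forall b, b < a -> tr (osucc b) S x) -> tr a S x.
Proof.
move=> Sx xl; elim/ord_ind: a => a IH al H.
case: (ord_kindP a) => [->|c ac|la]; first by apply/tr_zero.
  by rewrite ac; apply: H; rewrite ac osucc_gt.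
apply/tr_limit_lt => //; split=> // b ba; apply: IH => //; first exact: lt_trans al.
by move=> c cb; apply: H; exact: lt_trans ba.
Qed.

Lemma tr_sub_base (S : set ord) d : d = ozero \/ olimit d -> d < lam ->
  tr d S `<=` S.
Proof.
move=> [->|ld] dl x; first by move=> /tr_zero[].
by move=> /tr_limit_lt[]// _ /(_ _ ld.1) /tr_zero[].
Qed.

Lemma tr_cof_gt theta S a : S `<=` cof_gt lam theta -> a < lam ->
  tr a S `<=` cof_gt lam theta.
Proof.
move=> Sth; elim/ord_ind: a => a IH al x.
case: (ord_kindP a) => [->|c ac|la].
- by move=> /tr_zero[_ /Sth].
- have ca : c < a by rewrite ac osucc_gt.
  rewrite ac => /tr_succP[xl sx]; split=> //.
  exact: stationary_cof_gt (IH c ca (lt_trans ca al)) sx.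
- by move=> /tr_limit_lt[]// _ /(_ _ la.1) /tr_zero[_ /Sth].
Qed.

Lemma tr_mono (A B : set ord) a : A `<=` B -> a < lam -> tr a A `<=` tr a B.
Proof.
move=> AB; elim/ord_ind: a => a IH al x; case: (ord_kindP a) => [->|b ab|la].
- by move=> /tr_zero[xl /AB Bx]; apply/tr_zero.
- have ba : b < a by rewrite ab osucc_gt.
  by rewrite ab !tr_succ; apply: trace_sub; apply: IH (lt_trans ba al).
- move=> /tr_limit_lt[]// xl H; apply/tr_limit_lt => //; split=> // b ba.
  exact: IH (lt_trans ba al) _ (H b ba).
Qed.

(** The operator D of the overview: the diagonal intersection of all Tr_b(S), b < lam. The clause
    [ozero < x] excludes the point 0, where the other clause is vacuous, and so makes D(S) a subset
    of S. *)
Definition dtr (S : set ord) : set ord :=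
  [set x | ozero < x /\ forall b, b < x -> tr b S x].

Lemma dtr_sub S : dtr S `<=` S.
Proof. by move=> x [x0 /(_ _ x0) /tr_zero[]]. Qed.

Lemma dtr_lt_lam S x : dtr S x -> x < lam.
Proof. by move=> [x0 /(_ _ x0) /tr_lt_lam]. Qed.

Lemma dtr_mono (A B : set ord) : A `<=` B -> dtr A `<=` dtr B.
Proof.
move=> AB x Ax; split=> [|b bx]; first exact: Ax.1.
exact: tr_mono AB (lt_trans bx (dtr_lt_lam Ax)) _ (Ax.2 b bx).
Qed.

Lemma iter_dtr_mono n (A B : set ord) :
  A `<=` B -> iter n dtr A `<=` iter n dtr B.
Proof. by move=> AB; elim: n => //= n; exact: dtr_mono. Qed.

Lemma dtr_of_succ (S : set ord) x : S x -> ozero < x -> x < lam ->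
  (forall b, b < x -> tr (osucc b) S x) -> dtr S x.
Proof.
move=> Sx x0 xl H; split=> // b bx.
apply: tr_of_succ => //; first exact: lt_trans xl.
by move=> c cb; apply: H; exact: lt_trans bx.
Qed.

(** For b < x, the points of D(S) between b and x are stationary in x and belong to Tr_b(S), so x is
    in Tr_(b+1)(S). *)
Lemma trace_dtr (S : set ord) x : S x -> trace lam (dtr S) x -> dtr S x.
Proof.
move=> Sx /traceP[xl sx]; have [cx _] := sx.
apply: dtr_of_succ => //; first exact: ozero_lt_cof.
move=> b bx; apply/tr_succP; split=> //.
apply: stationary_sub (stationaryI sx (club_above cx bx)) => y _ [[_ H] [by_ _]].
exact: H.
Qed.

Lemma iter_dtr_sub n S : iter n dtr S `<=` S.
Proof. by elim: n => //= n; exact: subset_trans (@dtr_sub _). Qed.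

Lemma iter_dtr_le m n S : (m <= n)%N -> iter n dtr S `<=` iter m dtr S.
Proof. by move=> mn; rewrite -(subnK mn) iterD; exact: iter_dtr_sub. Qed.

(** Since Tr(D^(n+1)(S)) is included in Tr(D^n(S)), induction puts x in D^n(S), and [trace_dtr]
    applies to that set. *)
Lemma trace_iter_dtr n (S : set ord) x : S x ->
  trace lam (iter n dtr S) x -> iter n dtr S x.
Proof.
move=> Sx; elim: n => //= n IH sx; apply: trace_dtr => //; apply: IH.
exact: trace_sub (@dtr_sub _) _ sx.
Qed.
End Iterates.

(** * Inclusion modulo the nonstationary ideal *)

(** If h were unbounded on P, recursion of length lam would pick points of P with strictly
    increasing h-values, the regularity of lam keeping each initial segment bounded. This would
    inject lam into P. *)
Lemma small_of_card (lam : ord) (P : set ord) : cof lam = lam ->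
  ~ (below lam #<= P)%card -> small lam P.
Proof.
move=> clam nP h hl; apply: contrapT => nb; apply: nP.
have hub y : y < lam -> exists i, P i /\ y <= h i.
  move=> yl; apply: contrapT => ny; apply: nb; exists y; split=> // i Pi.
  by rewrite ltNge; apply/negP => yh; apply: ny; exists i.
pose good (z : ord) (g : forall w : ord, w < z -> ord) :=
  [set i | P i /\ forall (w : ord) (wz : w < z), h (g w wz) < h i].
pose g := Fix ord_lt_wf (fun=> ord) (fun z r => xget ozero (good z r)).
have gE z : g z = xget ozero [set i | P i /\ forall w, w < z -> h (g w) < h i].
  rewrite /g Fix_eq// => x r s rs; suff -> : r = s by [].
  by apply: functional_extensionality_dep => w; apply: funext => wx; exact: rs.
have gP z : z < lam -> P (g z) /\ forall w, w < z -> h (g w) < h (g z).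
  elim/ord_ind: z => z IH zl; rewrite gE; case: xgetP => [i _ []//|].
  have sz : small lam (below z) by apply: small_below; rewrite clam.
  have [y [yl hy]] := sz (h \o g) (fun w wz => hl _ (IH w wz (lt_trans wz zl)).1).
  have [i [Pi yi]] := hub y yl; move=> /(_ i); case; split=> // w wz.
  exact: lt_le_trans (hy w wz) yi.
have ginj : {in below lam &, injective g}.
  move=> z w; rewrite !inE => zl wl gzw; apply/eqP; rewrite eq_le !leNgt.
  apply/andP; split; apply/negP => lt.
    by have := (gP _ zl).2 _ lt; rewrite gzw ltxx.
  by have := (gP _ wl).2 _ lt; rewrite gzw ltxx.
apply: card_le_trans ((card_eqPle _ _).1 (inj_card_eq ginj)).2 _.
by apply: subset_card_le => _ [z /gP[Pz _] <-].
Qed.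

Section ModNS.
Variables (lam : ord) (e : ord -> set ord).
Hypothesis rlam : uncountable_regular lam.
Local Notation tr := (tr_iter lam e).
Local Notation dtr := (dtr lam e).

Lemma cof_regular : cof lam = lam. Proof. exact: rlam.2. Qed.

Lemma oomega_lt_cof : oomega < cof lam.
Proof. by rewrite cof_regular; exact: rlam.1. Qed.

Let cofl := oomega_lt_cof.

Lemma small_regular a : a < lam -> small lam (below a).
Proof. by move=> al; apply: small_below; rewrite cof_regular. Qed.

Definition subNS (A B : set ord) : Prop :=
  exists C, club lam C /\ forall x, C x -> A x -> B x.

Lemma subNS_above b (A B : set ord) : b < lam ->
  (forall x, b < x -> x < lam -> A x -> B x) -> subNS A B.
Proof.
by move=> bl AB; exists [set x | b < x /\ x < lam]; split;
  [exact: club_above|move=> x [bx xl]; exact: AB].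
Qed.

Lemma subNS_sub (A B : set ord) : A `<=` B -> subNS A B.
Proof. by move=> AB; exists (below lam); split; [exact: club_below|move=> x _ /AB]. Qed.

Lemma subNS_refl (A : set ord) : subNS A A.
Proof. by apply: subNS_sub. Qed.

Lemma subNS_trans (B A C : set ord) : subNS A B -> subNS B C -> subNS A C.
Proof.
move=> [D [cD AB]] [D' [cD' BC]]; exists (D `&` D'); split; first exact: club_setI.
by move=> x [Dx D'x] /(AB _ Dx) /(BC _ D'x).
Qed.

Lemma subNS_bigcap (I : Type) (P : set I) (A : set ord) (B : I -> set ord) :
  small lam P -> (forall i, P i -> subNS A (B i)) ->
  subNS A [set x | forall i, P i -> B i x].
Proof.
move=> sP AB; have ABC i : exists C, P i -> club lam C /\ forall x, C x -> A x -> B i x.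
  have [Pi|] := pselect (P i); last by exists set0.
  by have [C] := AB i Pi; exists C.
have [C hC] := choice ABC.
have [|E [cE EC]] := club_bigcap cofl (C := C) sP; first by move=> i /hC[].
exists E; split=> // x Ex Ax i Pi.
by have [_] := hC i Pi; apply=> //; exact: EC.
Qed.

Lemma subNS_setI (A B C : set ord) : subNS A B -> subNS A C -> subNS A (B `&` C).
Proof.
move=> [D [cD AB]] [D' [cD' AC]]; exists (D `&` D'); split; first exact: club_setI.
by move=> x [Dx D'x] Ax; split; [exact: AB|exact: AC].
Qed.

(** Normality of the club filter: the club consists of the limits d such that, for each x < d, all
    C_b with b <= x have a point between x and some y < d. *)
Lemma subNS_diag (A : set ord) (B : ord -> set ord) :
  (forall b, b < lam -> subNS A (B b)) ->
  subNS A [set x | forall b, b < x -> B b x].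
Proof.
move=> AB; have ABC b : exists C, b < lam -> club lam C /\ forall x, C x -> A x -> B b x.
  have [bl|] := pselect (b < lam); last by exists set0.
  by have [C] := AB b bl; exists C.
have [C hC] := choice ABC.
pose R x y := forall b, b <= x -> exists c, [/\ C b c, x < c & c <= y].
exists [set d | [/\ d < lam, olimit d & forall x, x < d -> exists y, y < d /\ R x y]].
split=> [|d [dl ld hd] Ad b bd]; last first.
  have bl : b < lam by exact: lt_trans dl.
  have [[_ _ clC]] := hC b bl; apply=> //; apply: clC => // x xd.
  have [|y [yd Ry]] := hd (Order.max b x); first by rewrite gt_max bd.
  have [|c [Cc]] := Ry b; first by rewrite le_max lexx.
  by rewrite gt_max => /andP[bc xc] cy; exists c; split=> //; exact: le_lt_trans yd.
apply: club_closing => // [x x' y x'x Rxy b bx'|x xl].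
  have [c [Cc xc cy]] := Rxy b (le_trans bx' x'x).
  by exists c; split=> //; exact: le_lt_trans xc.
have h1 b : exists c, b < lam -> [/\ C b c, x < c & c < lam].
  have [bl|] := pselect (b < lam); last by exists x.
  by have [[_ uC _] _] := hC b bl; have [c] := uC x xl; exists c.
have [h hP] := choice h1.
have sxl : osucc x < lam by exact: (olimit_cof cofl).2.
have [|y [yl hy]] := small_regular sxl (h := h).
  by move=> b bx; have [] := hP b (lt_trans bx sxl).
exists y; split=> // b bx; have bx' : b < osucc x by rewrite lt_osucc.
exists (h b); have [? ? ?] := hP b (lt_trans bx' sxl).
by split=> //; exact/ltW/hy.
Qed.

(** At a limit point x of C, the set C is a club of x, so that stationarity in x passes from A to
    B. *)
Lemma subNS_trace (A B : set ord) : subNS A B -> subNS (trace lam A) (trace lam B).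
Proof.
move=> [C [cC AB]]; have [_ uC _] := cC.
exists [set d | [/\ d < lam, olimit d & unbounded d C]].
split=> [|x [xl lx ux] /traceP[_ sx]]; first exact: club_limits.
apply/traceP; split=> //.
apply: stationary_sub (stationaryI sx (club_restrict cC (ltW xl) ux)).
by move=> y _ [Ay [Cy _]]; exact: AB.
Qed.

Lemma subNS_stationary (A B : set ord) :
  subNS A B -> stationary lam A -> stationary lam B.
Proof.
move=> [C [cC AB]] sA; apply: stationary_sub (stationaryI sA cC) => y _ [Ay Cy].
exact: AB.
Qed.

Lemma subNS_tr (A B : set ord) a : subNS A B -> a < lam ->
  subNS (tr a A) (tr a B).
Proof.
move=> AB; elim/ord_ind: a => a IH al; case: (ord_kindP a) => [->|b ab|la].
- have [C [cC H]] := AB; exists C; split=> // x Cx /tr_zero[xl Ax].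
  by apply/tr_zero; split=> //; exact: H.
- have ba : b < a by rewrite ab osucc_gt.
  by rewrite ab !tr_succ; apply: subNS_trace; apply: IH => //; exact: lt_trans al.
- apply: (@subNS_trans [set x | forall b, b < a -> (tr b B) x]).
    apply: (subNS_bigcap (small_regular al)) => b ba.
    apply: subNS_trans (IH b ba (lt_trans ba al)).
    by apply: subNS_sub => x /tr_limit_lt[]// _; exact.
  apply: subNS_sub => x H; apply/tr_limit_lt => //; split=> //.
  exact: tr_lt_lam (H _ la.1).
Qed.

Lemma subNS_dtr (A B : set ord) : subNS A B -> subNS (dtr A) (dtr B).
Proof.
move=> AB.
apply: (@subNS_trans (dtr A `&` [set x | forall b, b < x -> tr b B x])).
  apply: subNS_setI; first exact: subNS_refl.
  apply: subNS_diag => b bl; apply: subNS_trans (subNS_tr AB bl).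
  by apply: (subNS_above bl) => x bx _ [_]; exact.
by apply: subNS_sub => x [[x0 _] H].
Qed.

Local Notation L n := (omul lam (onat n)).

Lemma lam_gt0 : ozero < lam. Proof. exact: ozero_lt_cof cofl. Qed.

Lemma cof_oadd_limit c b : olimit b -> cof (oadd c b) <= b.
Proof.
move=> lb; apply: (@cof_le _ _ (oadd c)) => [x xb|y /(olimit_oadd_lt lb)[d [db yd]]].
  exact: oadd_lt2l.
by exists d; split=> //; exact: ltW.
Qed.

(** A short cofinal map into c + lam would, after subtracting c, be unbounded in the regular lam. *)
Lemma cof_oadd_regular c : cof (oadd c lam) = lam.
Proof.
have ll := olimit_cof cofl.
apply/eqP; rewrite eq_le cof_oadd_limit //= leNgt; apply/negP => cl.
have [h [hl hcof]] := cof_cofinal (oadd c lam).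
have sub x : exists d, x < cof (oadd c lam) -> d < lam /\ h x <= oadd c d.
  have [xl|] := pselect (x < cof (oadd c lam)); last by exists ozero.
  have [d [dl hd]] := olimit_oadd_lt ll (hl x xl).
  by exists d => _; split=> //; exact: ltW.
have [g gP] := choice sub.
have [|y [yl gy]] := small_regular cl (h := g); first by move=> x /gP[].
have [x [xl]] := hcof _ (oadd_lt2l c yl).
have [_ hx] := gP x xl; move=> /le_trans/(_ hx).
by rewrite leNgt oadd_lt2l //; exact: gy.
Qed.
End ModNS.

(** * The Galvin-Hajnal rank *)

Section Norm.
Variables theta lam : ord.
Hypothesis rtheta : uncountable_regular theta.
Hypothesis rlam : uncountable_regular lam.
Hypothesis GHlam : GH theta lam = lam.

Definition ev (P : ord -> Prop) : Prop :=
  exists b, b < theta /\ forall i, b <= i -> i < theta -> P i.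

Lemma ev_and (P Q : ord -> Prop) : ev P -> ev Q -> ev (fun i => P i /\ Q i).
Proof.
move=> [b [bt Pb]] [c [ct Qc]]; exists (Order.max b c); split.
  by rewrite gt_max bt.
by move=> i; rewrite ge_max => /andP[bi ci] it; split; [exact: Pb|exact: Qc].
Qed.

Lemma ev_sub (P Q : ord -> Prop) :
  (forall i, i < theta -> P i -> Q i) -> ev P -> ev Q.
Proof. by move=> PQ [b [bt Pb]]; exists b; split=> // i bi it; exact/PQ/Pb. Qed.

Lemma lt_bdP g f : lt_bd theta g f <-> ev (fun i => g i < f i).
Proof.
split=> -[b [bt H]]; exists b; split=> // i; last first.
  by move=> it fg; rewrite ltNge; apply/negP => bi; have := H i bi it; rewrite ltNge fg.
by move=> bi it; rewrite ltNge; apply/negP => /(H i it); rewrite ltNge bi.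
Qed.

Lemma lt_bd_trans f g h : lt_bd theta f g -> lt_bd theta g h -> lt_bd theta f h.
Proof.
move=> /lt_bdP fg /lt_bdP gh; apply/lt_bdP; apply: ev_sub (ev_and fg gh) => i _ [].
exact: lt_trans.
Qed.

(** Along a descending sequence of functions, the countably many exceptional bounds have a common
    bound i < theta, as cf(theta) > omega; the values at i would then descend forever. *)
Lemma lt_bd_wf : well_founded (lt_bd theta).
Proof.
move=> f0; apply: contrapT => nf0.
have step f : exists g, ~ Acc (lt_bd theta) f ->
    lt_bd theta g f /\ ~ Acc (lt_bd theta) g.
  have [accf|nf] := pselect (Acc (lt_bd theta) f); first by exists f.
  apply: contrapT => /forallNP ng; apply: nf; constructor => g gf.
  by apply: contrapT => ng'; apply: (ng g).
have [F FP] := choice step; pose u n := iter n F f0.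
have nu n : ~ Acc (lt_bd theta) (u n) by elim: n => //= n /FP[].
have uS n : ev (fun i => u n.+1 i < u n i) by apply/lt_bdP; have [] := FP _ (nu n).
have [b bP] := choice uS.
have ct : oomega < cof theta by rewrite rtheta.2 rtheta.1.
have [|i [it ib]] := small_nat ct (h := b); first by move=> n _; have [] := bP n.
have lt_u n : u n.+1 i < u n i.
  by have [_ H] := bP n; apply: H => //; exact/ltW/ib.
have [_ [[n ->] min]] := @ord_least [set x | exists n, x = u n i] (ex_intro _ (u 0%N i) (ex_intro _ 0%N erefl)).
by have := min (u n.+1 i) (ex_intro _ n.+1 erefl); rewrite leNgt lt_u.
Qed.

Lemma GHnorm_ev f g : ev (fun i => f i = g i) -> GHnorm theta f = GHnorm theta g.
Proof.
have sub f' g' h : ev (fun i => f' i = g' i) -> lt_bd theta h f' -> lt_bd theta h g'.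
  move=> fg /lt_bdP hf; apply/lt_bdP.
  by apply: ev_sub (ev_and fg hf) => i _ [->].
move=> fg; have gf : ev (fun i => g i = f i) by apply: ev_sub fg.
rewrite !GHnormE; [|exact: lt_bd_wf..]; congr osup; apply/seteqP.
by split=> a [h hf ->]; exists h => //; [exact: sub fg hf|exact: sub gf hf].
Qed.

Let GHset d := [set a | forall f : ord -> ord,
  (forall i, i < theta -> f i < d) -> GHnorm theta f < a].

(** [omin] returns [ozero] on the empty set. As GH(theta, lam) = lam is not zero, the minimum is
    attained, so lam itself bounds the norms. *)
Lemma GHset_lam : GHset lam lam.
Proof.
have [[a Xa]|n0] := pselect (GHset lam !=set0).
  by rewrite -{2}GHlam /GH; exact: (omin_in Xa).
have E : GHset lam = set0 by apply/seteqP; split=> // a Xa; apply: n0; exists a.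
by have := rlam.1; rewrite -GHlam /GH -/(GHset lam) E omin0 ltNge ozero_le.
Qed.

Let lam_gt0 : ozero < lam.
Proof. by apply: lt_trans rlam.1; apply/lt_oomega; exists 0%N. Qed.

(** Changing f off a tail puts all its values below d and preserves the norm. By [GHset_lam], the
    minimum defining GH(theta, d) is over a nonempty set. *)
Lemma GHnorm_lt_GH d f : d <= lam -> ev (fun i => f i < d) ->
  GHnorm theta f < GH theta d.
Proof.
move=> dl fd; have d0 : ozero < d.
  by have [b [bt H]] := fd; apply: le_lt_trans (H b (lexx b) bt); exact: ozero_le.
pose f' i := if f i < d then f i else ozero.
have f'd i : f' i < d by rewrite /f'; case: ifP.
rewrite (@GHnorm_ev f f'); last by apply: ev_sub fd => i _ h; rewrite /f' h.
have : GHset d (GH theta d); last exact.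
apply: (@omin_in _ lam) => g gd; apply: GHset_lam => i it.
exact: lt_le_trans (gd i it) dl.
Qed.

Lemma GHnorm_lt_lam f : lt_bd theta f (fun=> lam) -> GHnorm theta f < lam.
Proof. by move=> /lt_bdP fl; rewrite -GHlam; exact: GHnorm_lt_GH. Qed.

(** The supremum defining the norm of f is bounded by lam, hence is a true supremum and not the
    default. *)
Lemma GHnorm_lt f g : lt_bd theta f (fun=> lam) -> lt_bd theta g f ->
  GHnorm theta g < GHnorm theta f.
Proof.
move=> fl gf; rewrite (GHnormE (lt_bd_wf f)) -osucc_le.
set X := [set _ | _].
have [|Xle _] := @osup_least X lam; last by apply: Xle; exists g.
move=> _ [h hf ->]; rewrite osucc_le; apply: GHnorm_lt_lam.
exact: lt_bd_trans fl.
Qed.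

Let ll : olimit lam.
Proof. by apply: olimit_cof; rewrite rlam.2 rlam.1. Qed.

Let theta_gt0 : ozero < theta.
Proof. by apply: lt_trans rtheta.1; apply/lt_oomega; exists 0%N. Qed.

Lemma ev_all (P : ord -> Prop) : (forall i, i < theta -> P i) -> ev P.
Proof. by move=> H; exists ozero; split=> // i _; exact: H. Qed.

(** The norm of the constant function d exceeds that of every function below d, and is itself below
    lam. *)
Lemma GH_lt_lam d : d < lam -> GH theta d < lam.
Proof.
move=> dl; apply: (@le_lt_trans _ _ (GHnorm theta (fun=> d))).
  apply: omin_le => f fd; apply: GHnorm_lt.
    by apply/lt_bdP; exact: ev_all.
  by apply/lt_bdP; exact: ev_all.
by apply: GHnorm_lt_lam; apply/lt_bdP; exact: ev_all.
Qed.

Lemma GHnorm_const d : d < lam -> d <= GHnorm theta (fun=> d).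
Proof.
elim/ord_ind: d => d IH dl; rewrite leNgt; apply/negP => h.
have := IH _ h (lt_trans h dl); rewrite leNgt => /negP; apply.
by apply: GHnorm_lt; apply/lt_bdP; exact: ev_all.
Qed.

Lemma GH_ge d : d <= lam -> d <= GH theta d.
Proof.
move=> dl; rewrite leNgt; apply/negP => h.
have := @GHnorm_lt_GH d (fun=> GH theta d) dl (ev_all (fun=> fun=> h)).
by rewrite ltNge GHnorm_const // (lt_le_trans h).
Qed.

Lemma GHnorm_iter m f g : lt_bd theta f (fun=> lam) ->
  ev (fun i => iter m.+1 osucc (g i) <= f i) ->
  iter m osucc (GHnorm theta g) < GHnorm theta f.
Proof.
elim: m f => [|m IH] f fl gf; first by apply: GHnorm_lt => //; apply/lt_bdP;
  apply: ev_sub gf => i _; rewrite /= osucc_le.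
pose f' i := iter m.+1 osucc (g i).
have f'f : lt_bd theta f' f by apply/lt_bdP; apply: ev_sub gf => i _; rewrite /= osucc_le.
have f'l := lt_bd_trans f'f fl.
apply: le_lt_trans (GHnorm_lt fl f'f); rewrite /= osucc_le; apply: IH => //.
exact: ev_all.
Qed.

(** * Ranks of increasing unions *)

Section Union.
Variables (e : ord -> set ord) (S : ord -> set ord).
Hypothesis Sle : forall i j, i <= j -> j < theta -> S i `<=` S j.
Hypothesis Sth : forall i, i < theta -> S i `<=` cof_gt lam theta.
Local Notation tr := (tr_iter lam e).
Local Notation U := (\bigcup_(i in below theta) S i).

Lemma bigcup_cof_gt : U `<=` cof_gt lam theta.
Proof. by move=> x [i it]; exact: Sth. Qed.

(** If every Tr_b(S_i) is stationary in x, this is the junk value [ozero]; hence it always comes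
    with a proof that the trace at this level is nonstationary. *)
Definition local_rk (x i : ord) : ord :=
  omin [set b | ~ stationary x (tr b (S i))].

Lemma local_rkP x i b : ~ stationary x (tr b (S i)) ->
  local_rk x i <= b /\ ~ stationary x (tr (local_rk x i) (S i)).
Proof.
pose X : set ord := [set b | ~ stationary x (tr b (S i))].
by move=> nb; split; [exact: (@omin_le X b)|exact: (@omin_in X b)].
Qed.

(* tr_of_succ turns [x notin Tr_b] into a drop of rank only for x in S i; for *)
(* other x there is no drop when b is a limit.                                *)
Lemma local_rk_lt x i b : S i x -> x < lam -> b < lam ->
  ~ tr b (S i) x ->
  local_rk x i < b /\ ~ stationary x (tr (local_rk x i) (S i)).
Proof.
move=> Sx xl bl nb.
have [c [cb nc]] : exists c, c < b /\ ~ stationary x (tr c (S i)).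
  apply: contrapT => /forallNP nc; apply: nb.
  apply: tr_of_succ => // c cb; apply/tr_succP; split=> //.
  by apply: contrapT => ns; apply: (nc c).
by have [le_c nl] := local_rkP nc; split=> //; exact: le_lt_trans cb.
Qed.

(** As theta < cf(x), one club witnesses all these nonstationarities; indices off the tail
    contribute the trivial club. *)
Lemma avoid_traces x F : theta < cof x ->
  ev (fun i => ~ stationary x (tr (F i) (S i))) ->
  exists C, club x C /\ ev (fun i => forall y, C y -> ~ tr (F i) (S i) y).
Proof.
move=> tx [b [bt nF]].
have cx : oomega < cof x by exact: lt_trans rtheta.1 tx.
have exC i : exists C, (i < theta -> club x C) /\
    (b <= i -> i < theta -> forall y, C y -> ~ tr (F i) (S i) y).
  have [[bi it]|ni] := pselect (b <= i /\ i < theta).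
    by have [C [cC H]] := nonstationary_club cx (nF i bi it); exists C.
  exists (below x); split=> [_|bi it]; first exact: club_below.
  by exfalso; apply: ni.
have [C CP] := choice exC.
have [|E [cE EC]] := club_bigcap cx (C := C) (small_below tx).
  by move=> i /= it; have [H _] := CP i; exact: H.
exists E; split=> //; exists b; split=> // i bi it y Ey.
by have [_ H] := CP i; apply: (H bi it); exact: EC.
Qed.

(** A point of the union lies in S_i for all large i, because the S_i increase, so [local_rk_lt]
    applies on a tail. *)
Lemma local_rk_descent z F C : z < lam -> U z -> C z ->
  lt_bd theta F (fun=> lam) ->
  ev (fun i => forall y, C y -> ~ tr (F i) (S i) y) ->
  ev (fun i => local_rk z i < F i /\ ~ stationary z (tr (local_rk z i) (S i))).
Proof.
move=> zl [j jt Sz] Cz /lt_bdP Fl evC.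
have evS : ev (fun i => S i z) by exists j; split=> // i ji it; exact: Sle Sz.
apply: ev_sub (ev_and evS (ev_and Fl evC)) => i _ [Siz [Fil nF]].
by apply: local_rk_lt => //; exact: nF.
Qed.

(* The claim speaks of z in Tr_d, and not of the intermediate points, because *)
(* Tr_(d+k) need not be included in the union when k > 0.                     *)
Lemma trace_descent m d x F : d = ozero \/ olimit d -> iter m osucc d < lam ->
  x <= lam -> theta < cof x -> lt_bd theta F (fun=> lam) ->
  ev (fun i => ~ stationary x (tr (F i) (S i))) ->
  stationary x (tr (iter m osucc d) U) ->
  forall D, club x D -> exists z, [/\ z < x, D z, tr d U z,
    ev (fun i => ~ stationary z (tr (local_rk z i) (S i))) &
    ev (fun i => iter m.+1 osucc (local_rk z i) <= F i)].
Proof.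
move=> d0l; elim: m x F => [|m IH] x F al xl tx Fl nF sU D cD;
  have [C [cC evC]] := avoid_traces tx nF;
  have cx : oomega < cof x by exact: lt_trans rtheta.1 tx.
  have [z [[Uz Dz] Cz]] := (stationaryI sU cD).2 _ cC.
  have zl := tr_lt_lam Uz.
  have U0z := tr_sub_base d0l al Uz.
  have H := local_rk_descent zl U0z Cz Fl evC.
  exists z; split=> //; first by have [C1 _ _] := cC; exact: C1.
    by apply: ev_sub H => i _ [].
  by apply: ev_sub H => i _ [+ _]; rewrite /= osucc_le.
have al' : iter m osucc d < lam by apply: lt_trans al; exact: osucc_gt.
have cCD := club_setI cx cC cD; have [_ uCD _] := cCD.
(* A limit point y of the club is chosen, so that the club restricts to y and the induction can
   continue inside it. As y need not lie in the union, its rank is only known to be at most F(i). *)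
have [y [Uy [yx ly uy]]] := sU.2 _ (club_limits cx uCD).
have /tr_succP[yl sy] := Uy.
have ty := stationary_cof_gt (tr_cof_gt bigcup_cof_gt al') sy.
have cy := club_restrict cCD (ltW yx) uy.
have Cy : C y.
  by have [_ _ C3] := cC; apply: C3 => // w /uy[c [[Cc _] wc cy']]; exists c.
have nFy : ev (fun i => ~ stationary y (tr (F i) (S i))).
  apply: ev_sub evC => i _ nC sF.
  by have [w [Fw [[Cw _] _]]] := sF.2 _ cy; exact: nC Fw.
have nloc : ev (fun i => ~ stationary y (tr (local_rk y i) (S i))).
  by apply: ev_sub nFy => i _ /local_rkP[].
have locl : lt_bd theta (local_rk y) (fun=> lam).
  apply/lt_bdP; move/lt_bdP : Fl => Fl.
  apply: ev_sub (ev_and Fl nFy) => i _ [Fil nF'].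
  by have [h _] := local_rkP nF'; exact: le_lt_trans Fil.
have [z [zy [[Cz Dz] _] Uz nz zloc]] := IH y _ al' (ltW yl) ty locl nloc sy _ cy.
have zl := lt_trans zy yl.
have U0z := tr_sub_base d0l (le_lt_trans (iter_osucc_ge m d) al') Uz.
have H := local_rk_descent zl U0z Cz Fl evC.
exists z; split=> //; first exact: lt_trans yx.
apply: ev_sub (ev_and zloc (ev_and H evC)) => i it [zi [[Hi _] nC]].
(* The one missing successor is gained here. If F(i) = b + 1, then y avoids Tr_(b+1)(S_i), so the
   rank at y is at most b. If F(i) is a limit, the rank at z is below it, and so are its finite
   successors. *)
case: (ord_kindP (F i)) => [F0|b Fb|lF].
- by move: Hi; rewrite F0 ltNge ozero_le.
- rewrite Fb iterS osucc_le2; have nb : ~ stationary y (tr b (S i)).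
    by move=> sb; apply: (nC y Cy); rewrite Fb; apply/tr_succP.
  by have [h _] := local_rkP nb; exact: le_trans zi h.
- exact/ltW/olimit_iter.
Qed.

(** F is any function bounding the ranks at x, so that the lemma applies to bounds obtained by
    choice; the induction on a is uniform in x and F. *)
Lemma stationary_lt_GHnorm a x F : a < lam -> x <= lam -> theta < cof x ->
  lt_bd theta F (fun=> lam) ->
  ev (fun i => ~ stationary x (tr (F i) (S i))) ->
  stationary x (tr a U) -> a < GHnorm theta F.
Proof.
elim/ord_ind: a x F => a IH x F al xl tx Fl nF sU.
have [m [d [aE d0l]]] := ord_decomp a.
have ad : d <= a by rewrite aE iter_osucc_ge.
have dl : d < lam by exact: le_lt_trans al.
have cx : oomega < cof x by exact: lt_trans rtheta.1 tx.
have [z [zx _ Uz nz zF]] : exists z, [/\ z < x, below x z, tr d U z,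
    ev (fun i => ~ stationary z (tr (local_rk z i) (S i))) &
    ev (fun i => iter m.+1 osucc (local_rk z i) <= F i)].
  by apply: trace_descent => //; rewrite -?aE //; exact: club_below.
rewrite aE; apply: le_lt_trans (GHnorm_iter Fl zF); apply: iter_osucc_le.
case: d0l => [->|ld]; first exact: ozero_le.
(* If c = ||G|| were below the limit d, then z would be in Tr_(c+1)(U), so Tr_c(U) would be
   stationary in z, and induction at z would give c < c. *)
rewrite leNgt; apply/negP => nd.
have /(tr_limit_lt _ _ _ ld dl)[zl tz] := Uz.
set c := GHnorm theta (local_rk z).
have /tr_succP[_ sz] := tz _ (ld.2 _ nd).
have : c < c; last by rewrite ltxx.
apply: (IH c _ z) => //; first exact: lt_le_trans ad.
- exact: lt_trans dl.
- exact: ltW.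
- by have [] := tr_cof_gt bigcup_cof_gt dl Uz.
- apply/lt_bdP; move/lt_bdP : Fl => Fl.
  apply: ev_sub (ev_and Fl zF) => i _ [Fil zFi]; apply: le_lt_trans Fil.
  apply: le_trans zFi.
  exact: iter_osucc_ge.
Qed.
End Union.
End Norm.

(** * Diagonal traces of increasing unions *)

Section DiagonalUnion.
Variables (theta lam : ord) (e : ord -> set ord).
Hypothesis rtheta : uncountable_regular theta.
Hypothesis rlam : uncountable_regular lam.
Hypothesis GHlam : GH theta lam = lam.
Local Notation dtr := (dtr lam e).

Lemma dtr_bigcup (S : ord -> set ord) :
  (forall i j, i <= j -> j < theta -> S i `<=` S j) ->
  (forall i, i < theta -> S i `<=` cof_gt lam theta) ->
  subNS lam (dtr (\bigcup_(i in below theta) S i))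
            (\bigcup_(i in below theta) dtr (S i)).
Proof.
move=> Sle Sth; set U := \bigcup_(i in below theta) S i.
apply: (@subNS_trans _ rlam (dtr U `&` [set x | forall b, b < x -> GH theta b < x])).
  apply: (subNS_setI rlam); first exact: subNS_refl.
  apply: (subNS_diag rlam) => b bl.
  by apply: (subNS_above rlam (GH_lt_lam rtheta rlam GHlam bl)).
apply: subNS_sub => // x [Ux GHx]; apply: contrapT => nx.
have xl := dtr_lt_lam Ux.
have [j jt Sj] := dtr_sub Ux.
have tx : theta < cof x by have [] := Sth j jt x Sj.
have cx : oomega < cof x by exact: lt_trans rtheta.1 tx.
(* As x is in S_i for i >= j but in no D(S_i), some Tr_b(S_i) with b < x is nonstationary in x. *)
have rank i : exists b, b < x /\
    (j <= i -> i < theta -> ~ stationary x (tr_iter lam e b (S i))).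
  have [[ji it]|ni] := pselect (j <= i /\ i < theta); last first.
    by exists ozero; split=> [|ji it]; [exact: Ux.1|exfalso; apply: ni].
  apply: contrapT => /forallNP nb; apply: nx; exists i => //.
  apply: dtr_of_succ => //; [exact: Sle Sj|exact: Ux.1|].
  move=> b bx; apply/tr_succP; split=> //; apply: contrapT => nsb.
  by apply: (nb b).
have [F FP] := choice rank.
have [|y [yx Fy]] := small_below tx (h := F); first by move=> i _; have [] := FP i.
have lx := olimit_cof cx.
(* The successor matters: x in Tr_(g+1)(U), for g = GH(theta, y), makes Tr_g(U) stationary in x.
   Then g < ||F||, against ||F|| < g. *)
have gx : osucc (GH theta y) < x by apply: lx.2; exact: GHx.
have [_ /(_ _ gx) /tr_succP[_ sx]] := Ux.
have yl := lt_trans yx xl.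
have Fyev : ev theta (fun i => F i < y) by exists j; split=> // i _; exact: Fy.
have := GHnorm_lt_GH rtheta rlam GHlam (ltW yl) Fyev.
rewrite ltNge => /negP; apply; apply: ltW.
apply: (@stationary_lt_GHnorm theta lam rtheta rlam GHlam e S Sle Sth _ x) => //.
- exact: lt_trans (osucc_gt _) (lt_trans gx xl).
- exact: ltW.
- by apply/lt_bdP; apply: ev_sub Fyev => i _ Fi; exact: lt_trans yl.
- by exists j; split=> // i ji it; have [_] := FP i; exact.
Qed.

Lemma iter_dtr_bigcup n (S : ord -> set ord) :
  (forall i j, i <= j -> j < theta -> S i `<=` S j) ->
  (forall i, i < theta -> S i `<=` cof_gt lam theta) ->
  subNS lam (iter n dtr (\bigcup_(i in below theta) S i))
            (\bigcup_(i in below theta) iter n dtr (S i)).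
Proof.
move=> Sle Sth; elim: n => [|n IH]; first exact: subNS_refl.
apply: (subNS_trans rlam (subNS_dtr e rlam IH)); apply: dtr_bigcup.
  by move=> i j ij jt; apply: iter_dtr_mono; exact: Sle.
by move=> i it; apply: subset_trans (Sth i it); exact: iter_dtr_sub.
Qed.
End DiagonalUnion.

(** * Traces beyond lam *)

Section Canonical.
Variables (lam : ord) (e : ord -> set ord) (S : set ord).
Hypothesis rlam : uncountable_regular lam.
Hypothesis esys : club_system lam e.
Local Notation tr := (tr_iter lam e).
Local Notation L n := (omul lam (onat n)).
Local Notation D n := (iter n (dtr lam e) S).
Local Notation "A <=* B" := (subNS lam A B) (at level 70).

Lemma tr_limit_cof_lt a x : olimit a -> lam <= a -> cof a < lam ->
  tr a S x <-> x < lam /\ forall b, b < a -> e a b -> tr b S x.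
Proof.
move=> la al ca; rewrite tr_iterE; split=> [[xl]|[xl ax]]; last first.
  by split=> //; constructor 4; rewrite ca.
case=> [[a0 _]|[b [_ [ab _]]]|[_ al' _]|[_ _]].
- by move: la.1; rewrite a0 ltxx.
- by move: la; rewrite ab => /not_olimit_osucc.
- by move: al; rewrite leNgt al'.
- by rewrite ca.
Qed.

Lemma tr_limit_cof_eq a x : olimit a -> lam <= a -> cof a = lam ->
  tr a S x <-> x < lam /\
    forall z, oenum lam (e a) z < a -> z < x -> tr (oenum lam (e a) z) S x.
Proof.
move=> la al ca; rewrite tr_iterE; split=> [[xl]|[xl ax]]; last first.
  by split=> //; constructor 4; rewrite ca ltxx.
case=> [[a0 _]|[b [_ [ab _]]]|[_ al' _]|[_ _]].
- by move: la.1; rewrite a0 ltxx.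
- by move: la; rewrite ab => /not_olimit_osucc.
- by move: al; rewrite leNgt al'.
- by rewrite ca ltxx.
Qed.

Definition canonical a := forall k z, a = oadd (L k) z -> z < lam ->
  (tr a S <=* tr z (D k)) /\ (tr z (D k) <=* tr a S).

(** Above z, a point of D^(j+1)(S) belongs to Tr_z(D^j(S)) by the definition of D. *)
Lemma iter_dtr_subNS j k z : (j < k)%N -> z < lam -> D k <=* tr z (D j).
Proof.
move=> jk zl; apply: (subNS_above rlam zl) => x zx _ /(iter_dtr_le jk)[_].
exact.
Qed.

(** Each b < a is lam * j + z with j < k, where D^k(S) suffices, or with j = k and z < w. The value
    w = lam serves a = lam * (k + 1). *)
Lemma canonical_upper (A : set ord) a k w : a = oadd (L k) w -> w <= lam ->
  (forall b, b < a -> canonical b) ->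
  A `<=` D k -> (forall z, z < w -> A <=* tr z (D k)) ->
  forall b, b < a -> A <=* tr b S.
Proof.
move=> aE wl IH AD Aw b ba; have := ba; rewrite aE.
move=> /(lt_omul_onatD (lam_gt0 rlam) wl)[j [z [zl bE jk]]].
apply: (subNS_trans rlam) (IH b ba j z bE zl).2.
case: jk => [jk|[jk zw]]; last by rewrite jk; exact: Aw.
by apply: (subNS_trans rlam) (iter_dtr_subNS jk zl); exact: subNS_sub.
Qed.

(** The ladder of a has a point lam * k + z' with z' > z + 1, and Tr_z' is included in Tr_(z+1), a
    successor stage. *)
Lemma canonical_lower (A : set ord) a k w z : a = oadd (L k) w -> olimit w ->
  w <= lam -> (forall b, b < a -> canonical b) -> unbounded a (e a) ->
  (forall b, e a b -> b < a -> A <=* tr b S) ->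
  z < w -> A <=* tr (osucc z) (D k).
Proof.
move=> aE lw wl IH ue Ae zw.
have [|b [eb zb ba]] := ue (oadd (L k) (osucc z)).
  by rewrite aE oadd_lt2l // lw.2.
have [z' [z'w bE]] : exists z', z' < w /\ b = oadd (L k) z'.
  by apply: oadd_subl; rewrite -?aE //; exact: le_trans (oadd_ge _ _) (ltW zb).
have z'l := lt_le_trans z'w wl.
apply: (subNS_trans rlam (Ae b eb ba)).
apply: (subNS_trans rlam (IH b ba k z' bE z'l).1).
apply: subNS_sub => //; apply: tr_lt_succ => //.
rewrite -osucc_le leNgt; apply/negP => z'z.
by move: zb; rewrite bE ltNge oadd_le2l // ltW.
Qed.

(** Recovers stage zero over D^k(S), which the successor stages do not give. At limit stages of
    [canonicalP], S x comes from [ozero] being in the ladder. *)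
Lemma iter_dtr_of_succ k x : S x -> tr (osucc ozero) (D k) x -> D k x.
Proof.
move=> Sx; rewrite tr_succ => tx; apply: trace_iter_dtr (Sx) _.
by apply: trace_sub tx => y /tr_zero[].
Qed.

(** Induction on a = lam * k + z. For k > 0 and a limit, both inclusions compare the intersection
    along the ladder with the one over all smaller levels. *)
Lemma canonicalP a : a < card_succ lam -> canonical a.
Proof.
elim/ord_ind: a => a IH' ak k z aE zl.
have IH b : b < a -> canonical b by move=> ba; apply: IH' => //; exact: lt_trans ak.
have lam0 := lam_gt0 rlam.
have ll : olimit lam := olimit_cof (oomega_lt_cof rlam).
case: k aE => [|k] aE.
  have -> : a = z by rewrite aE omul_onat0 oadd0o.
  by split; exact: subNS_refl.
case: (ord_kindP z) aE => [->|y zE|lz] aE.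
(* Here z = 0, and a is read as lam * k + lam: it has cofinality lam, and the diagonal intersection
   along its ladder is D(D^k(S)) modulo nonstationary sets. *)
- have {}aE : a = oadd (L k) lam by rewrite aE oaddo0 omul_onatS.
  have la : olimit a by rewrite aE; exact: olimit_oadd.
  have lam_a : lam <= a by rewrite aE oadd_ger.
  have ca : cof a = lam by rewrite aE cof_oadd_regular.
  have [[ea uea _] ea0 /(_ ca) enum _] := esys la lam_a ak.
  have [_ himg] : is_enum lam (e a) (oenum lam (e a)) by exact: xgetPex.
  set h := oenum lam (e a) in himg.
  split; last first.
    apply: (@subNS_trans _ rlam (D k.+1)).
      by apply: subNS_sub => // x /tr_zero[].
    have up b : b < a -> D k.+1 <=* tr b S.
      apply: (canonical_upper aE (lexx _) IH); first exact: dtr_sub.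
      by move=> y yl; exact: iter_dtr_subNS.
    apply: (@subNS_trans _ rlam (D k.+1 `&`
        [set x | forall y, y < x -> h y < a -> tr (h y) S x])).
      apply: (subNS_setI rlam); first exact: subNS_refl.
      apply: (subNS_diag rlam) => y yl.
      have hya : h y < a by apply: ea; rewrite -himg; exists y.
      apply: (subNS_trans rlam) (up _ hya) _.
      by apply: subNS_sub => // x Hx _.
    apply: subNS_sub => // x [Dx H]; apply/(tr_limit_cof_eq x la lam_a ca).
    by split=> [|y ya yx]; [exact: dtr_lt_lam Dx|exact: H].
  have low b : e a b -> b < a -> tr a S <=* tr b S.
    rewrite -himg => -[y yl <-] hya; apply: (subNS_above rlam yl) => x yx _.
    by move=> /(tr_limit_cof_eq x la lam_a ca)[_]; exact.
  apply: (@subNS_trans _ rlam ([set x | ozero < x] `&` (tr ozero S `&`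
      [set x | forall y, y < x -> tr (osucc y) (D k) x]))).
    apply: (subNS_setI rlam); first exact: (subNS_above rlam lam0).
    apply: (subNS_setI rlam); first by apply: low => //; exact: la.1.
    by apply: (subNS_diag rlam) => y; exact: canonical_lower (lexx _) IH uea low.
  apply: subNS_sub => // x [x0 [/tr_zero[xl Sx] H]].
  apply/tr_zero; split=> //.
  by apply: dtr_of_succ => //; apply: iter_dtr_of_succ => //; exact: H.
- have yz : y < z by rewrite zE osucc_gt.
  have {}aE : a = osucc (oadd (L k.+1) y) by rewrite aE zE oaddS.
  have ya : oadd (L k.+1) y < a by rewrite aE osucc_gt.
  have [H1 H2] := IH _ ya k.+1 y erefl (lt_trans yz zl).
  by rewrite aE zE !tr_succ; split; exact: subNS_trace.
(* For z limit, cf(a) <= z < lam, and the ladder has fewer than lam points, so plain intersections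
   are compared. *)
- have la : olimit a by rewrite aE; exact: olimit_oadd.
  have lam_a : lam <= a.
    by rewrite aE; apply: le_trans (oadd_ge _ _); exact: omul_onat_ge.
  have ca : cof a < lam by rewrite aE; exact: le_lt_trans (cof_oadd_limit _ lz) zl.
  have [[ea uea _] ea0 _ /(_ ca) /(small_of_card rlam.2) sea] := esys la lam_a ak.
  split; last first.
    have up b : b < a -> tr z (D k.+1) <=* tr b S.
      apply: (canonical_upper aE (ltW zl) IH).
        by apply: tr_sub_base => //; right.
      move=> y yz; apply: subNS_sub => // x.
      by move=> /(tr_limit_lt _ _ _ lz zl)[_]; exact.
    apply: (@subNS_trans _ rlam (tr z (D k.+1) `&` [set x | forall b, e a b -> tr b S x])).
      apply: (subNS_setI rlam); first exact: subNS_refl.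
      by apply: (subNS_bigcap rlam sea) => b /ea; exact: up.
    apply: subNS_sub => // x [Tx H]; apply/(tr_limit_cof_lt x la lam_a ca).
    by split=> [|b _]; [exact: tr_lt_lam Tx|exact: H].
  have low b : e a b -> b < a -> tr a S <=* tr b S.
    move=> eb ba; apply: subNS_sub => // x.
    by move=> /(tr_limit_cof_lt x la lam_a ca)[_]; exact.
  apply: (@subNS_trans _ rlam (tr ozero S `&`
      [set x | forall y, y < z -> tr (osucc y) (D k.+1) x])).
    apply: (subNS_setI rlam); first by apply: low => //; exact: la.1.
    apply: (subNS_bigcap rlam (small_regular rlam zl)) => y.
    exact: canonical_lower lz (ltW zl) IH uea low.
  apply: subNS_sub => // x [/tr_zero[xl Sx] H].
  by apply: tr_of_succ => //; apply: iter_dtr_of_succ => //; exact: H lz.1.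
Qed.
End Canonical.

(** * The rank of the union *)

Lemma rk_le (lam : ord) e S a : a < card_succ lam ->
  ~ stationary lam (tr_iter lam e a S) -> rk lam e S <= a.
Proof. by move=> al na; apply: omin_le; left. Qed.

Lemma rk_le_card_succ (lam : ord) e S : rk lam e S <= card_succ lam.
Proof. by apply: omin_le; right. Qed.

(** The bound g <= lam^+ rules out the default value of [rk]. *)
Lemma rk_lt (lam : ord) e S g : rk lam e S < g -> g <= card_succ lam ->
  exists a, [/\ a < g, a < card_succ lam & ~ stationary lam (tr_iter lam e a S)].
Proof.
rewrite /rk; set X := (X in omin X) => rg gl.
have : X (omin X) by apply: (@omin_in _ (card_succ lam)); right.
by case=> [[al na]|rE]; [exists (omin X)|move: rg; rewrite rE ltNge gl].
Qed.

(** Passing to the sets D^n(S_i) removes the summand lam * n: their ranks are bounded by some F(i) <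
    beta, and c = ||F|| < GH(theta, beta) bounds the rank of their union. *)
Lemma rk_bigcup_lt (lam theta beta : ord) (n : nat)
    (e : ord -> set ord) (S : ord -> set ord) :
  uncountable_regular lam -> club_system lam e -> theta < lam ->
  uncountable_regular theta -> GH theta lam = lam ->
  ozero < beta -> beta < lam ->
  oadd (omul lam (onat n)) beta <= card_succ lam ->
  (forall i j, i <= j -> j < theta -> S i `<=` S j) ->
  (forall i, i < theta -> S i `<=` cof_gt lam theta) ->
  (forall i, i < theta -> rk lam e (S i) < oadd (omul lam (onat n)) beta) ->
  rk lam e (\bigcup_(i in below theta) S i)
    < oadd (omul lam (onat n)) (GH theta beta).
Proof.
move=> rlam esys tl rtheta GHlam b0 bl gk Sle Sth Srk.
pose D k A := iter k (dtr lam e) A.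
have rank i : exists b, i < theta ->
    b < beta /\ ~ stationary lam (tr_iter lam e b (D n (S i))).
  have [it|] := pselect (i < theta); last by exists ozero.
  have [a [ag ak na]] := rk_lt (Srk i it) gk.
  have [j [z [zl aE jn]]] := lt_omul_onatD (lam_gt0 rlam) (ltW bl) ag.
  have [_ sub] := canonicalP (S i) rlam esys ak aE zl.
  have nz : ~ stationary lam (tr_iter lam e z (D j (S i))).
    by move=> sz; apply: na; exact: subNS_stationary sub sz.
  case: jn => [jn|[jn zb]]; last by exists z => _; rewrite -jn.
  (* If the rank of S_i is already below lam * n, then D^n(S_i) is nonstationary, and F(i) = 0 <
     beta works. *)
  exists ozero => _; split=> // s0; apply: nz.
  apply: subNS_stationary (iter_dtr_subNS e (S i) rlam jn zl) _.
  by apply: stationary_sub s0 => y _ /tr_zero[].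
have [F FP] := choice rank.
have Fb : ev theta (fun i => F i < beta).
  by apply: ev_all => // i /FP[].
have cGH : GHnorm theta F < GH theta beta.
  exact: (GHnorm_lt_GH rtheta rlam GHlam (ltW bl) Fb).
set c := GHnorm theta F in cGH.
have cl : c < lam by apply: lt_trans cGH _; exact: GH_lt_lam.
have nc : ~ stationary lam (tr_iter lam e c (\bigcup_(i in below theta) D n (S i))).
  move=> sc; have : c < c; last by rewrite ltxx.
  apply: (@stationary_lt_GHnorm theta lam rtheta rlam GHlam e (fun i => D n (S i)) _ _ _ lam) => //.
  - by move=> i j ij jt; apply: iter_dtr_mono; exact: Sle.
  - by move=> i it; apply: subset_trans (Sth i it); exact: iter_dtr_sub.
  - by rewrite rlam.2.
  - by apply/lt_bdP; apply: ev_sub Fb => i _ Fi; exact: lt_trans bl.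
  - by apply: ev_all => // i /FP[].
apply: le_lt_trans (oadd_lt2l (omul lam (onat n)) cGH).
(* When lam * n + c reaches lam^+, the bound [rk] <= lam^+ suffices. *)
case: (ltP (oadd (omul lam (onat n)) c) (card_succ lam)) => [ak|]; last first.
  exact: le_trans (rk_le_card_succ _ _ _).
apply: rk_le => // sa; apply: nc.
have [sub _] := canonicalP (\bigcup_(i in below theta) S i) rlam esys ak erefl cl.
apply: subNS_stationary _ (subNS_stationary sub sa).
exact: (subNS_tr e rlam (iter_dtr_bigcup e rtheta rlam GHlam n Sle Sth) cl).
Qed.

Theorem theorem3p1
    (lam theta : ord) (n : nat) (beta gamma : ord)
    (e : ord -> set ord) (S : ord -> set ord) :
  inaccessible lam ->
  club_system lam e ->
  theta < lam ->
  uncountable_regular theta ->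
  GH theta lam = lam ->
  beta < lam ->
  gamma = (lam * onat n + beta)%ord ->
  (forall i j, i <= j -> j < theta -> S i `<=` S j) ->
  (forall i, i < theta -> S i `<=` cof_gt lam theta) ->
  (forall i, i < theta -> rk lam e (S i) < gamma) ->
  rk lam e (\bigcup_(i in below theta) S i)
      < (lam * onat n + GH theta beta)%ord /\
  (lam * onat n + GH theta beta)%ord < (lam * onat n.+1)%ord.
Proof.
move=> [rlam _] esys tl rtheta GHlam bl -> Sle Sth Srk.
have lam0 := lam_gt0 rlam.
have GHb := GH_lt_lam rtheta rlam GHlam bl.
split; last by rewrite omul_onatS // oadd_lt2l.
have GHge := GH_ge rtheta rlam GHlam (ltW bl).
(* If the bound exceeds lam^+ there is nothing to prove, because rk <= lam^+. *)
(* This spares us the cardinal arithmetic lam * n + beta < lam^+.             *)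
case: (ltP (card_succ lam) (lam * onat n + beta)%ord) => [kg|gk].
  exact: le_lt_trans (rk_le_card_succ _ _ _) (lt_le_trans kg (oadd_le2l _ GHge)).
have [b0|] := ltP ozero beta; first exact: rk_bigcup_lt.
move=> b_le0; have {b_le0} b0 : beta = ozero by apply/eqP; rewrite eq_le b_le0 ozero_le.
have t0 : ozero < theta by apply: lt_trans rtheta.1; apply/lt_oomega; exists 0%N.
rewrite {}b0 oaddo0 in gk Srk *.
apply: lt_le_trans (oadd_ge _ _).
case: n => [|m] in gk Srk *.
  by have := Srk _ t0; rewrite omul_onat0 ltNge ozero_le.
(* With beta = 0, the ranks are below lam * m + d_i for some d_i < lam. As theta < lam and lam is
   regular, one y < lam exceeds all d_i, and GH(theta, y) < lam. *)
rewrite omul_onatS // in gk Srk *.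
have ll := olimit_cof (oomega_lt_cof rlam).
have low i : exists d, i < theta -> d < lam /\
    rk lam e (S i) < oadd (omul lam (onat m)) d.
  have [it|] := pselect (i < theta); last by exists ozero.
  by have [d dP] := olimit_oadd_lt ll (Srk i it); exists d.
have [d dP] := choice low.
have [|y [yl dy]] := small_regular rlam tl (h := d); first by move=> i /dP[].
have H := @rk_bigcup_lt lam theta y m e S rlam esys tl rtheta GHlam.
apply: lt_trans (H _ yl _ Sle Sth _) _.
- exact: le_lt_trans (ozero_le _) (dy _ t0).
- by apply: le_trans gk; exact/ltW/oadd_lt2l.
- move=> i it; have [_ /lt_trans] := dP i it; apply; exact/oadd_lt2l/dy.
- exact/oadd_lt2l/GH_lt_lam.
Qed.
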